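(* Let $q$ be a prime power and let $\ell, m, n, k$ be positive integers with $1\le k\le n$, $\ell\le q-1$, and let $(n_1,\dots,n_\ell)$ be an ordered partition of $n$ (positive integers with $\sum_l n_l=n$). Let $Z_1,\dots,Z_k\subseteq[n]$. Suppose $q\ge \ell+1$ and $m\ge \max_{l\in[\ell]}\{k-1+\log_q k,\ n_l\}$. Then there exists an $[n,k]_{q^m}$ linearized Reed–Solomon code with $\ell$ blocks of lengths $n_1,\dots,n_\ell$ having a generator matrix $\boldsymbol G\in\mathbb F_{q^m}^{k\times n}$ with $G_{ij}=0$ for all $i\in[k]$ and all $j\in Z_i$ if and only if for every nonempty $\Omega\subseteq[k]$, $$\Big|\bigcap_{i\in\Omega}Z_i\Big|+|\Omega|\le k .$$
   Context: $[a]=\{1,\dots,a\}$. Let $\sigma:\mathbb F_{q^m}\to\mathbb F_{q^m}$, $\sigma(a)=a^q$. Two elements $a,b\in\mathbb F_{q^m}$ are $\sigma$-conjugate if $b=a c^{q-1}$ for some $c\in\mathbb F_{q^m}^*$; this is an equivalence relation whose classes partition $\mathbb F_{q^m}$ ($\{0\}$ plus $q-1$ classes of nonzero elements). For $a\in\mathbb F_{q^m}$ and $i\ge0$ let $N_i(a)=a^{(q^i-1)/(q-1)}$. Columns are indexed by pairs $(l,t)$, $l\in[\ell]$, $t\in[n_l]$, with column index $j=t+\sum_{r<l}n_r$. A linearized Reed–Solomon (LRS) code of dimension $k$ with blocks $(n_1,\dots,n_\ell)$ (requiring $n_l\le m$) is specified by block representatives $a_1,\dots,a_\ell\in\mathbb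 F_{q^m}^*$ lying in pairwise distinct $\sigma$-conjugacy classes and column multipliers $\beta_{l,1},\dots,\beta_{l,n_l}\in\mathbb F_{q^m}$ that are $\mathbb F_q$-linearly independent for each $l$; it is the $\mathbb F_{q^m}$-row space of the $k\times n$ matrix whose entry in row $i\in\{0,\dots,k-1\}$ and column $(l,t)$ is $N_i(a_l)\,\beta_{l,t}^{q^i}$. Equivalently, it is $\{(\beta_{l,t}\, f(a_l\beta_{l,t}^{q-1}))_{(l,t)} : f=\sum_{i<k} f_iX^i\}$ with $f(\alpha)=\sum_i f_iN_i(\alpha)$. *)

(* Defs.v *)
From HB Require Import structures.
From mathcomp Require Import all_boot all_order all_algebra all_field.
Set Implicit Arguments. Unset Strict Implicit. Unset Printing Implicit Defensive.
Import GRing.Theory.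
Local Open Scope ring_scope.

Definition prime_power (q : nat) : Prop :=
  exists p e : nat, prime p /\ (0 < e)%N /\ q = (p ^ e)%N.

(* sigma-conjugacy in F = F_{q^m}, sigma(a) = a^q : b = a c^(q-1), c <> 0 *)
Definition sigma_conj (F : fieldType) (q : nat) (a b : F) : Prop :=
  exists c : F, c != 0 /\ b = a * c ^+ (q - 1).

Definition Nq (F : fieldType) (q i : nat) (a : F) : F :=
  a ^+ ((q ^ i - 1) %/ (q - 1)).

(* column j (0-based) lies in block l (0-based) of the partition n_ *)
Definition in_block (ell : nat) (n_ : 'I_ell -> nat) (l : 'I_ell) (j : nat) : bool :=
  ((\sum_(r < ell | (r < l)%N) n_ r)%N <= j < (\sum_(r < ell | (r <= l)%N) n_ r)%N)%N.

(* elements of F_q inside F: the fixed points of sigma *)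
Definition in_Fq (F : fieldType) (q : nat) (c : F) : bool := c ^+ q == c.

Definition block_Fq_indep (F : fieldType) (q ell n : nat) (n_ : 'I_ell -> nat)
  (beta : 'I_n -> F) (l : 'I_ell) : Prop :=
  forall c : 'I_n -> F,
    (forall j : 'I_n, in_Fq q (c j)) ->
    \sum_(j < n | in_block n_ l j) c j * beta j = 0 ->
    forall j : 'I_n, in_block n_ l j -> c j = 0.

(* the k x n matrix with entry N_i(a_l) beta_{l,t}^{q^i} in row i, column (l,t);
   for a partition exactly one block contains j *)
Definition LRS_matrix (F : fieldType) (q k ell n : nat) (n_ : 'I_ell -> nat)
  (a : 'I_ell -> F) (beta : 'I_n -> F) : 'M[F]_(k, n) :=
  \matrix_(i < k, j < n)
    \sum_(l < ell | in_block n_ l j) Nq q i (a l) * beta j ^+ (q ^ i).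

Definition LRS_params (F : fieldType) (q ell n : nat) (n_ : 'I_ell -> nat)
  (a : 'I_ell -> F) (beta : 'I_n -> F) : Prop :=
  (forall l, a l != 0) /\
  (forall l l', l != l' -> ~ sigma_conj q (a l) (a l')) /\
  (forall l, block_Fq_indep q n_ beta l).

Definition generator_of (F : fieldType) (k n : nat) (G M : 'M[F]_(k, n)) : bool :=
  row_free G && (G == M)%MS.

(* Main.v *)
(** Let [X] act on the field by [y -> a y^q]. The codeword of a skew polynomial
of degree less than [k] is the list of its values at the points [(a_l, beta)],
and a nonzero skew polynomial of degree [d] vanishes on at most [d] points of a
valid evaluation set: divide on the right by [X - b], where [b] is the conjugate
of [a_l] for which this factor vanishes at one of the points. Hence the code is
MDS, which gives the necessity of the condition.

For sufficiency, enlarge the [Z_i] until each has [k - 1] elements, keeping the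
condition, and let row [i] of the generator matrix be the monic annihilator
[f_i] of the points indexed by [Z_i]. It remains to choose the points so that
the [f_i] are linearly independent. For generic points over the algebraic
closure this is shown more generally for the families [X^(t_i + e) f_i] with
[e < d_i], by induction. A tight proper subfamily is merged into one member; if
at most one [t_i] is zero, a factor [X] is cancelled; otherwise some point is
sent to [0], where the annihilator acquires a left factor [X]. Finally the
points are moved one at a time into the finite field: the determinant has degree
at most [(k - 1) (q - 1) q^(k-2)] in each point, and at most [q^(m-1)] values
depend linearly on the earlier points of the block. *)

Require Import Defs.
From HB Require Import structures.
From mathcomp Require Import all_boot all_order all_algebra all_field.
From mathcomp Require Import cyclic ring zify.
Set Implicit Arguments. Unset Strict Implicit.
Unset Printing Implicit Defensive.
Import GRing.Theory.
Local Open Scope ring_scope.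

(** * Skew polynomials and their modules *)

Section SkewAction.
Variables (K : nzRingType) (phi : {rmorphism K -> K}).
Variables (V : lmodType K) (T : {linear V -> V | phi \; *:%R}).
Implicit Types (p r : {poly K}) (u v : V).

(* A skew polynomial [\sum_i p_i X^i], with [X c = phi c X], is stored as the
   ordinary polynomial with the same left coefficients, and a module over the
   skew polynomial ring as a vector space with a [phi]-semilinear map [T]. *)
Definition skew_act p v : V := \sum_(i < size p) p`_i *: iter i T v.

Lemma skew_act_widen N p v :
  (size p <= N)%N -> skew_act p v = \sum_(i < N) p`_i *: iter i T v.
Proof.
move=> le_pN.
rewrite /skew_act (big_ord_widen N (fun i => p`_i *: iter i T v) le_pN).
rewrite big_mkcond; apply: eq_bigr => i _; case: ltnP => // le_pi.
by rewrite nth_default ?scale0r.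
Qed.

Lemma skew_actDl p r v : skew_act (p + r) v = skew_act p v + skew_act r v.
Proof.
pose N := maxn (size p) (size r).
rewrite !(@skew_act_widen N) ?leq_maxl ?leq_maxr ?size_polyD // -big_split.
by apply: eq_bigr => i _; rewrite coefD scalerDl.
Qed.

Lemma skew_actZl c p v : skew_act (c *: p) v = c *: skew_act p v.
Proof.
rewrite (@skew_act_widen (size p)) ?size_scale_leq // scaler_sumr.
by apply: eq_bigr => i _; rewrite coefZ scalerA.
Qed.

Lemma skew_actBl p r v : skew_act (p - r) v = skew_act p v - skew_act r v.
Proof. by rewrite -[in LHS]scaleN1r skew_actDl skew_actZl scaleN1r. Qed.

Lemma skew_act0l v : skew_act 0 v = 0.
Proof. by rewrite /skew_act size_poly0 big_ord0. Qed.

Lemma skew_act_suml (J : Type) (s : seq J) (P : pred J) (p : J -> {poly K}) v :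
  skew_act (\sum_(j <- s | P j) p j) v = \sum_(j <- s | P j) skew_act (p j) v.
Proof.
exact: (big_morph (skew_act^~ v) (fun p r => skew_actDl p r v) (skew_act0l v)).
Qed.

Lemma skew_actC c v : skew_act c%:P v = c *: v.
Proof. by rewrite (skew_act_widen _ (size_polyC_leq1 c)) big_ord1 coefC. Qed.

Lemma skew_actMX p v : skew_act (p * 'X) v = skew_act p (T v).
Proof.
rewrite (@skew_act_widen (size p).+1); last first.
  by apply: leq_trans (size_polyMleq _ _) _; rewrite size_polyX addn2.
rewrite big_ord_recl coefMX scale0r add0r.
by apply: eq_bigr => i _; rewrite coefMX -iterSr.
Qed.

Lemma iter_semilinearB n : {morph iter n T : u v / u - v}.
Proof. by move=> u v; elim: n => //= n ->; rewrite raddfB. Qed.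

Lemma skew_act_is_zmod_morphism p : zmod_morphism (skew_act p).
Proof.
move=> u v; rewrite /skew_act -sumrB.
by apply: eq_bigr => i _; rewrite iter_semilinearB scalerBr.
Qed.

HB.instance Definition _ p :=
  GRing.isZmodMorphism.Build V V (skew_act p) (skew_act_is_zmod_morphism p).

End SkewAction.

Section SkewProduct.
Variables (K : nzRingType) (phi : {rmorphism K -> K}).
Implicit Types (c : K) (p r f : {poly K}).

Definition skewX p : {poly K} := 'X * map_poly phi p.

Lemma skewX_is_linear : linear_for (phi \; *:%R) skewX.
Proof.
move=> c p r; rewrite /skewX -!commr_polyX rmorphD mulrDl /= map_polyZ /=.
by rewrite scalerAl.
Qed.

HB.instance Definition _ :=
  GRing.isLinear.Build K {poly K} {poly K} (phi \; *:%R) skewX skewX_is_linear.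

Definition skew_mul : {poly K} -> {poly K} -> {poly K} := skew_act skewX.

Lemma coef_skewX p i : (skewX p)`_i = if i is i'.+1 then phi p`_i' else 0.
Proof. by rewrite /skewX coefXM; case: i => //= i; rewrite coef_map. Qed.

Lemma size_skewX_leq p : (size (skewX p) <= (size p).+1)%N.
Proof.
rewrite /skewX -commr_polyX (leq_trans (size_polyMleq _ _)) //.
by rewrite size_polyX addn2 ltnS size_poly.
Qed.

Lemma size_iter_skewX n p : (size (iter n skewX p) <= size p + n)%N.
Proof.
elim: n => [|n IHn] /=; first by rewrite addn0.
by rewrite addnS (leq_trans (size_skewX_leq _)).
Qed.

Lemma size_skew_mul_leq N p r :
  (size p + size r <= N.+1)%N -> (size (skew_mul p r) <= N)%N.
Proof.
move=> le_N; apply: leq_trans (size_sum _ _ _) _; apply/bigmax_leqP => i _.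
apply: leq_trans (size_scale_leq _ _) _.
apply: leq_trans (size_iter_skewX _ _) _.
by rewrite -ltnS -addnS addnC (leq_trans _ le_N) // leq_add2r.
Qed.

Lemma coef0_skew_mul p r : (skew_mul p r)`_0 = p`_0 * r`_0.
Proof.
rewrite /skew_mul (skew_act_widen _ _ (leqnSn (size p))) big_ord_recl coefD.
rewrite coefZ coef_sum big1 ?addr0 // => i _.
by rewrite coefZ lift0 /= coef_skewX mulr0.
Qed.

Section Associativity.
Variables (V : lmodType K) (T : {linear V -> V | phi \; *:%R}).

Lemma skew_act_skewX p v : skew_act T (skewX p) v = T (skew_act T p v).
Proof.
rewrite (skew_act_widen _ _ (size_skewX_leq p)) big_ord_recl coef_skewX scale0r.
rewrite add0r raddf_sum; apply: eq_bigr => i _.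
by rewrite coef_skewX /= linearZ.
Qed.

Lemma skew_actA p r v :
  skew_act T (skew_mul p r) v = skew_act T p (skew_act T r v).
Proof.
rewrite [X in skew_act T X v]/skew_act skew_act_suml; apply: eq_bigr => i _.
rewrite skew_actZl; congr (_ *: _).
by elim: (val i) => //= n <-; rewrite skew_act_skewX.
Qed.

End Associativity.

Lemma skew_mulA p r f : skew_mul p (skew_mul r f) = skew_mul (skew_mul p r) f.
Proof. by rewrite [RHS]skew_actA. Qed.

Lemma iter_skewX1 n : iter n skewX 1 = 'X^n.
Proof. by elim: n => //= n ->; rewrite /skewX map_polyXn exprS. Qed.

Lemma skew_mulp1 p : skew_mul p 1 = p.
Proof.
rewrite -[RHS]coefK poly_def; apply: eq_bigr => i _.
by rewrite iter_skewX1.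
Qed.

Lemma skewX_mul p r :
  skewX (skew_mul p r) = skew_mul (map_poly phi p) (skewX r).
Proof. by rewrite -[LHS]skew_act_skewX /skewX -commr_polyX [LHS]skew_actMX. Qed.

Lemma iter_skewX_mul m n p r : (m <= n)%N -> exists2 h : {poly K},
  (size h <= size p + (n - m))%N &
    iter n skewX (skew_mul p r) = skew_mul h (iter m skewX r).
Proof.
move=> le_mn; pose p' := iter m (map_poly phi) p.
exists (iter (n - m) skewX p').
  apply: leq_trans (size_iter_skewX _ _) _; rewrite leq_add2r /p'.
  by elim: m {le_mn p'} => //= m; apply: leq_trans (size_poly _ _).
rewrite -{1}(subnK le_mn) iterD.
have -> : iter m skewX (skew_mul p r) = skew_mul p' (iter m skewX r).
  by rewrite /p'; elim: m {le_mn p'} => //= m ->; rewrite skewX_mul.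
by elim: (n - m)%N => //= l ->; rewrite -[LHS]skew_act_skewX.
Qed.

Lemma skew_divXsubC b p : exists r c,
  (size r <= (size p).-1)%N /\ p = skew_mul r ('X - b%:P) + c%:P.
Proof.
have [n] := ubnP (size p); elim: n p => // n IHn p; rewrite ltnS => le_pn.
have [/size1_polyC p_const|p_gt1] := leqP (size p) 1.
  by exists 0, p`_0; rewrite size_poly0 /skew_mul skew_act0l add0r.
pose p' := drop_poly 1 p.
have size_p' : size p' = (size p).-1 by rewrite size_drop_poly subn1.
pose rest : {poly K} := skew_mul p' b%:P + (p`_0)%:P.
have size_rest : (size rest <= (size p).-1)%N.
  apply: leq_trans (size_polyD _ _) _; rewrite geq_max; apply/andP; split.
    apply: size_skew_mul_leq.
    by rewrite size_p' -addn1 leq_add2l size_polyC_leq1.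
  by apply: leq_trans (size_polyC_leq1 _) _; lia.
have [|r [c [size_r restE]]] := IHn rest; first by lia.
exists (p' + r), c; split.
  apply: leq_trans (size_polyD _ _) _; rewrite geq_max size_p' leqnn.
  exact: leq_trans size_r (leq_trans (leq_pred _) size_rest).
rewrite /skew_mul skew_actDl -addrA -restE raddfB /= /rest addrA subrK.
rewrite -[LHS](poly_take_drop 1) -/p' expr1 [LHS]addrC; congr (_ + _).
  rewrite -[LHS]skew_mulp1 /skew_mul skew_actMX.
  by congr (skew_act _ _ _); apply: (iter_skewX1 1).
by apply/polyP => -[|i]; rewrite coef_take_poly coefC.
Qed.

End SkewProduct.

Section SkewProductField.
Variables (K : fieldType) (phi : {rmorphism K -> K}).
Implicit Types p : {poly K}.

Local Notation S := (skewX phi).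

Lemma size_skewX p : p != 0 -> size (S p) = (size p).+1.
Proof.
move=> p_neq0; rewrite /skewX -commr_polyX size_mulX ?map_poly_eq0 //.
by rewrite size_map_poly.
Qed.

Lemma skewX_monic p : p \is monic -> S p \is monic.
Proof. by move=> mon_p; rewrite /skewX rpredM ?monicX ?map_monic. Qed.

End SkewProductField.

Section Evaluation.
Variables (K : fieldType) (phi : {rmorphism K -> K}).
Implicit Types (a b c y : K) (p r : {poly K}).

Definition sigma_op a (y : K^o) : K^o := a * phi y.

Lemma sigma_op_is_linear a : linear_for (phi \; *:%R) (sigma_op a).
Proof. by move=> c y z; rewrite /sigma_op rmorphD rmorphM mulrDr mulrCA. Qed.

HB.instance Definition _ a :=
  GRing.isLinear.Build K K^o K^o (phi \; *:%R) (sigma_op a)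
    (sigma_op_is_linear a).

Definition skew_eval a p y : K := skew_act (sigma_op a) p (y : K^o).

Lemma skew_eval_is_zmod_morphism a p : zmod_morphism (skew_eval a p).
Proof. by move=> y z; rewrite /skew_eval raddfB. Qed.

HB.instance Definition _ a p :=
  GRing.isZmodMorphism.Build K K (skew_eval a p)
    (skew_eval_is_zmod_morphism a p).

Lemma skew_evalDl a p r y :
  skew_eval a (p + r) y = skew_eval a p y + skew_eval a r y.
Proof. exact: (skew_actDl (sigma_op a)). Qed.

Lemma skew_evalBl a p r y :
  skew_eval a (p - r) y = skew_eval a p y - skew_eval a r y.
Proof. exact: (skew_actBl (sigma_op a)). Qed.

Lemma skew_evalZl a c p y : skew_eval a (c *: p) y = c * skew_eval a p y.
Proof. exact: (skew_actZl (sigma_op a)). Qed.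

Lemma skew_evalC a c y : skew_eval a c%:P y = c * y.
Proof. exact: (skew_actC (sigma_op a)). Qed.

Lemma skew_eval_skewX a p y :
  skew_eval a (skewX phi p) y = a * phi (skew_eval a p y).
Proof. exact: (skew_act_skewX (sigma_op a)). Qed.

Lemma skew_eval_mul a p r y :
  skew_eval a (skew_mul phi p r) y = skew_eval a p (skew_eval a r y).
Proof. exact: (skew_actA (sigma_op a)). Qed.

Lemma skew_eval_XsubC a b y : skew_eval a ('X - b%:P) y = a * phi y - b * y.
Proof.
rewrite skew_evalBl skew_evalC; congr (_ - _).
by rewrite -['X]mul1r [LHS]skew_actMX [LHS]skew_actC scale1r.
Qed.

Lemma iter_sigma_op_fixed a n c y :
  phi c = c -> iter n (sigma_op a) (c * y) = c * iter n (sigma_op a) y.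
Proof.
move=> c_fixed; elim: n => //= n ->.
by rewrite /sigma_op rmorphM c_fixed mulrCA.
Qed.

Lemma skew_eval_fixed a p c y :
  phi c = c -> skew_eval a p (c * y) = c * skew_eval a p y.
Proof.
move=> c_fixed; rewrite /skew_eval /skew_act mulr_sumr; apply: eq_bigr => i _.
by rewrite iter_sigma_op_fixed // [LHS]mulrCA.
Qed.

Lemma skew_root_factor a y p : y != 0 -> skew_eval a p y = 0 ->
  exists2 r : {poly K}, (size r <= (size p).-1)%N &
    p = skew_mul phi r ('X - (a * phi y / y)%:P).
Proof.
move=> y_neq0; set b := a * phi y / y.
have [r [c [size_r pE]]] := skew_divXsubC phi b p.
rewrite {1}pE skew_evalDl skew_evalC skew_eval_mul skew_eval_XsubC divfK //.
rewrite subrr raddf0 add0r => /eqP.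
rewrite mulf_eq0 (negPf y_neq0) orbF => /eqP c0.
by exists r; rewrite // pE c0 polyC0 addr0.
Qed.

End Evaluation.

Section PowerEvaluation.
Variables (K : fieldType) (q : nat) (phi : {rmorphism K -> K}).
Hypothesis phiE : forall x, phi x = x ^+ q.
Hypothesis q_gt1 : (1 < q)%N.

Implicit Types (a y : K) (p : {poly K}).

Local Notation ev := (skew_eval phi).

Lemma iter_sigma_opE a n y :
  iter n (sigma_op phi a) y = iter n (sigma_op phi a) 1 * y ^+ (q ^ n).
Proof.
elim: n => [|n IHn] /=; first by rewrite mul1r.
by rewrite {1}IHn /sigma_op rmorphM (phiE (y ^+ _)) -exprM -expnSr mulrA.
Qed.

Lemma iter_sigma_op1_neq0 a n : a != 0 -> iter n (sigma_op phi a) 1 != 0.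
Proof.
move=> a_neq0; elim: n => [|n IHn] /=; first exact: oner_neq0.
by rewrite /sigma_op mulf_neq0 ?fmorph_eq0.
Qed.

Lemma skew_evalE a p N y : (size p <= N)%N ->
  ev a p y = \sum_(i < N) p`_i * (iter i (sigma_op phi a) 1 * y ^+ (q ^ i)).
Proof.
move=> le_pN; rewrite /skew_eval (skew_act_widen _ _ le_pN).
by apply: eq_bigr => i _; rewrite [iter i _ y]iter_sigma_opE.
Qed.

Lemma exprq_split (x : K) : x ^+ q = x * x ^+ (q - 1).
Proof. by rewrite -exprS subn1 prednK // ltnW. Qed.

Definition linearized_poly a p : {poly K} :=
  \sum_(i < size p) (p`_i * iter i (sigma_op phi a) 1) *: 'X^(q ^ i).

Lemma horner_linearized_poly a p y : (linearized_poly a p).[y] = ev a p y.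
Proof.
rewrite horner_sum (skew_evalE _ _ (leqnn _)); apply: eq_bigr => i _.
by rewrite hornerZ hornerXn mulrA.
Qed.

Lemma size_linearized_poly_leq a p :
  (size (linearized_poly a p) <= (q ^ (size p).-1).+1)%N.
Proof.
apply: leq_trans (size_sum _ _ _) _; apply/bigmax_leqP => i _.
apply: leq_trans (size_scale_leq _ _) _; rewrite size_polyXn ltnS leq_exp2l //.
by have := ltn_ord i; lia.
Qed.

Lemma linearized_poly_neq0 a p : a != 0 -> p != 0 -> linearized_poly a p != 0.
Proof.
move=> a_neq0 p_neq0.
have size_p : ((size p).-1 < size p)%N by rewrite ltn_predL size_poly_gt0.
apply/eqP => /polyP/(_ (q ^ (size p).-1)%N)/eqP; apply/negP.
rewrite coef0 coef_sum (bigD1 (Ordinal size_p)) //= big1 ?addr0 => [|i].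
  rewrite coefZ coefXn eqxx mulr1 mulf_neq0 ?iter_sigma_op1_neq0 //.
  by rewrite -lead_coefE lead_coef_eq0.
rewrite -val_eqE /= eq_sym coefZ coefXn eqn_exp2l // => /negPf->.
by rewrite mulr0.
Qed.

End PowerEvaluation.

(** * Zeros of a skew polynomial *)

Section Zeros.
Variables (K : fieldType) (q : nat) (phi : {rmorphism K -> K}).
Hypothesis phiE : forall x, phi x = x ^+ q.
Hypothesis q_gt1 : (1 < q)%N.

Local Notation ev := (skew_eval phi).

Lemma conj_of_common_root a a' y y' : y != 0 -> y' != 0 ->
  a' * phi y' = a * phi y / y * y' -> a = a' * (y' / y) ^+ (q - 1).
Proof.
move=> y_neq0 y'_neq0; rewrite !phiE !(exprq_split q_gt1) => root_y'.
rewrite expr_div_n mulrA; apply: (canRL (mulfK (expf_neq0 _ y_neq0))).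
apply: (mulIf y'_neq0); transitivity (a' * (y' * y' ^+ (q - 1))); last by ring.
by rewrite root_y'; field.
Qed.

Variables (I : finType) (alpha : I -> K).
Hypothesis alpha_neq0 : forall j, alpha j != 0.
Hypothesis alpha_conj :
  forall i j, sigma_conj q (alpha i) (alpha j) -> alpha i = alpha j.
Implicit Types (A B : {set I}) (beta : I -> K).

Definition class_indep B beta : Prop :=
  forall (c : I -> K) a, (forall j, phi (c j) = c j) ->
    \sum_(j in B | alpha j == a) c j * beta j = 0 ->
    forall j, j \in B -> alpha j = a -> c j = 0.

Lemma class_indep_subset A B beta :
  A \subset B -> class_indep B beta -> class_indep A beta.
Proof.
move=> sAB indep c a c_fixed sum0 j jA aj.
pose c' i := if i \in A then c i else 0.
suff : c' j = 0 by rewrite /c' jA.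
apply: (indep c' a) => [i||//|//]; last exact: (subsetP sAB).
  by rewrite /c'; case: ifP => // _; rewrite rmorph0.
rewrite -[RHS]sum0 [LHS](big_setIDcond _ B A) (setIidPr sAB) /=.
rewrite [X in _ + X]big1 ?addr0.
  by apply: eq_bigr => i /andP[iA _]; rewrite /c' iA.
by move=> i; rewrite inE /c' => /andP[/andP[/negPf-> _] _]; rewrite mul0r.
Qed.

Lemma class_indep_neq0 B beta j : class_indep B beta -> j \in B -> beta j != 0.
Proof.
move=> indep jB; apply/eqP => beta_j; pose c i : K := (i == j)%:R.
have c_fixed i : phi (c i) = c i by rewrite rmorph_nat.
suff /eqP : c j = 0 by rewrite /c eqxx oner_eq0.
apply: (indep c (alpha j)) => //; rewrite big1 // => i _; rewrite /c.
by case: eqP => [->|_]; rewrite ?beta_j ?mulr0 ?mul0r.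
Qed.

(* Here [X - b] vanishes at the point [j]. A relation among its values at the
   other points is a root [y] of [X - b], hence a fixed multiple of [beta j],
   and so extends to a relation among the points themselves. *)
Lemma class_indep_divide B beta j : class_indep B beta -> j \in B ->
  let b := alpha j * phi (beta j) / beta j in
  class_indep (B :\ j) (fun i => ev (alpha i) ('X - b%:P) (beta i)).
Proof.
move=> indep jB b c a c_fixed sum0 i iB ai.
have beta_j := class_indep_neq0 indep jB.
pose y := \sum_(l in B :\ j | alpha l == a) c l * beta l.
have root_y : a * phi y = b * y.
  apply/eqP; rewrite -subr_eq0 -skew_eval_XsubC -[X in _ == X]sum0 raddf_sum /=.
  apply/eqP; apply: eq_bigr => l /andP[_ /eqP <-].
  by rewrite skew_eval_fixed.
have [ratio_fixed y_other] :
    phi (y / beta j) = y / beta j /\ (alpha j != a -> y = 0).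
  have [->|y_neq0] := eqVneq y 0; first by rewrite mul0r rmorph0.
  have aE := conj_of_common_root beta_j y_neq0 root_y.
  have jaE : alpha j = a.
    rewrite -ai; apply/esym/alpha_conj; exists (y / beta j).
    by rewrite mulf_neq0 ?invr_eq0 // ai.
  split; last by rewrite jaE eqxx.
  rewrite phiE (exprq_split q_gt1) -[RHS]mulr1; congr (_ * _).
  by apply: (mulfI (alpha_neq0 j)); rewrite mulr1 {1}jaE -aE.
pose c' l := if l == j then - (y / beta j) else c l.
have -> : c i = c' i by move: iB; rewrite /c' in_setD1 => /andP[/negPf->].
apply: (indep c' a) => // [l||]; last by case/setD1P: iB.
  by rewrite /c'; case: ifP => // _; rewrite rmorphN ratio_fixed.
have sumE : \sum_(l in B :\ j | alpha l == a) c' l * beta l = y.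
  by apply: eq_bigr => l /andP[]; rewrite in_setD1 /c' => /andP[/negPf-> _].
have [jaE|ja_neq] := eqVneq (alpha j) a.
  rewrite (bigD1 j) ?jB ?jaE ?eqxx //= {1}/c' eqxx mulNr divfK //.
  rewrite (eq_bigl [pred l in B :\ j | alpha l == a]) ?sumE ?addNr // => l /=.
  by rewrite in_setD1 andbAC (andbC (l \in B)).
rewrite -[RHS]y_other // -sumE; apply: eq_bigl => l.
by rewrite in_setD1; case: (l =P j) => //= ->; rewrite (negPf ja_neq) andbF.
Qed.

Lemma skew_poly_eq0 B beta (p : {poly K}) :
  class_indep B beta -> (size p <= #|B|)%N ->
  (forall j, j \in B -> ev (alpha j) p (beta j) = 0) -> p = 0.
Proof.
have [n] := ubnP #|B|; elim: n B beta p => // n IHn B beta p; rewrite ltnS.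
move=> le_Bn indep size_p p_zero; have [B0|[j jB]] := set_0Vmem B.
  by move: size_p; rewrite B0 cards0 leqn0 size_poly_eq0 => /eqP.
have [r size_r pE] :=
  skew_root_factor (class_indep_neq0 indep jB) (p_zero j jB).
have cardB := cardsD1 j B; rewrite jB in cardB.
suff r0 : r = 0 by rewrite pE r0 [LHS]skew_act0l.
apply: IHn (class_indep_divide indep jB) _ _; [by lia|by lia|].
by move=> i /setD1P[_ iB]; rewrite -skew_eval_mul -pE p_zero.
Qed.

End Zeros.

(** * Annihilators of evaluation points *)

Section Annihilators.
Variables (K : fieldType) (q : nat) (phi : {rmorphism K -> K}).
Hypothesis phiE : forall x, phi x = x ^+ q.
Hypothesis q_gt1 : (1 < q)%N.
Variables (I : eqType) (alpha : I -> K).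
Implicit Types (f : {poly K}) (g : I -> K) (s t : seq I).

Local Notation S := (skewX phi).
Local Notation ev := (skew_eval phi).

(* The conjugate of [alpha j] by the value of [f] at the point [g j]: the factor
   [X - conj_value g f j] on the left of [f] kills this value. When it is
   already [0], the conjugate is [0] and the factor is [X]. *)
Definition conj_value g f j : K := alpha j * ev (alpha j) f (g j) ^+ (q - 1).

Fixpoint annih g s : {poly K} :=
  if s is j :: s' then
    S (annih g s') - conj_value g (annih g s') j *: annih g s'
  else 1.

Lemma conj_value0 g f j : g j = 0 -> conj_value g f j = 0.
Proof.
by move=> gj; rewrite /conj_value gj raddf0 expr0n subn_eq0 leqNgt q_gt1 mulr0.
Qed.

Lemma annih_monic_size g s :
  annih g s \is monic /\ size (annih g s) = (size s).+1.
Proof.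
elim: s => [|j s [mon_s size_s]] /=; first by rewrite monic1 size_poly1.
have size_X : size (S (annih g s)) = (size s).+2.
  by rewrite size_skewX ?monic_neq0 // size_s.
set c := conj_value _ _ _; set f := annih g s in mon_s size_s size_X *.
have lt_size : (size (- (c *: f)) < size (S f))%N.
  by rewrite size_polyN size_X ltnS (leq_trans (size_scale_leq _ _)) ?size_s.
split; last by rewrite size_polyDl.
by rewrite monicE lead_coefDl // -monicE skewX_monic.
Qed.

Lemma eq_annih g g' s : {in s, g =1 g'} -> annih g s = annih g' s.
Proof.
elim: s => //= j s IHs eq_g.
rewrite /conj_value eq_g ?mem_head // IHs // => i i_s.
by apply: eq_g; rewrite inE i_s orbT.
Qed.

Lemma annih_root g s j : j \in s -> ev (alpha j) (annih g s) (g j) = 0.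
Proof.
elim: s => //= i s IHs; rewrite inE skew_evalBl skew_evalZl skew_eval_skewX.
have [-> _|_ /= /IHs->] := eqVneq j i; last by rewrite rmorph0 !mulr0 subrr.
by rewrite phiE (exprq_split q_gt1) /conj_value; ring.
Qed.

Lemma expr_q1N (x : K) : (- x) ^+ (q - 1) = x ^+ (q - 1).
Proof.
have [->|x_neq0] := eqVneq x 0; first by rewrite oppr0.
apply: (mulfI x_neq0).
rewrite -(exprq_split q_gt1) -[X in X * _ = _]opprK mulNr.
by rewrite -(exprq_split q_gt1) -!phiE rmorphN opprK.
Qed.

Lemma conj_value_subZ g f c j : conj_value g (S f - c *: f) j =
  conj_value g f j * (conj_value g f j - c) ^+ (q - 1).
Proof.
rewrite /conj_value skew_evalBl skew_evalZl skew_eval_skewX phiE.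
rewrite (exprq_split q_gt1); set u := ev (alpha j) f (g j).
rewrite (_ : _ - c * u = u * (alpha j * u ^+ (q - 1) - c)); last by ring.
by rewrite exprMn mulrA.
Qed.

Lemma annih_cons2 g i j s : let f := annih g s in
  let a := conj_value g f i in let b := conj_value g f j in
  annih g (i :: j :: s) =
    S (S f) - (b ^+ q + a * (a - b) ^+ (q - 1)) *: S f
    + (a * b * (a - b) ^+ (q - 1)) *: f.
Proof.
move=> f a b; rewrite /= -/f -/b conj_value_subZ -/a raddfB /= linearZ /= phiE.
rewrite scalerBr scalerA scalerDl !opprD opprK !addrA; congr (_ + _ *: _).
by ring.
Qed.

Lemma annih_swap g i j s : annih g (i :: j :: s) = annih g (j :: i :: s).
Proof.
rewrite !annih_cons2; set f := annih g s.
set a := conj_value g f i; set b := conj_value g f j.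
rewrite -[b - a]opprB expr_q1N (mulrC b a).
set c := (a - b) ^+ (q - 1); suff -> : b ^+ q + a * c = a ^+ q + b * c by [].
have : (a - b) * c = a ^+ q - b ^+ q.
  by rewrite -(exprq_split q_gt1) -!phiE rmorphB.
by rewrite mulrBl => /(canRL (subrK _)) ->; ring.
Qed.

Lemma annih_cat_cons g j t s : annih g (t ++ j :: s) = annih g (j :: t ++ s).
Proof. by elim: t => // i t IHt; rewrite annih_swap /= IHt. Qed.

Lemma perm_annih g s t : perm_eq s t -> annih g s = annih g t.
Proof.
elim: s t => [|j s IHs] t; first by rewrite perm_sym => /perm_nilP->.
move=> eq_st; have := mem_head j s; rewrite (perm_mem eq_st) => j_t.
case/splitPr: j_t eq_st => t1 t2.
rewrite annih_cat_cons perm_sym perm_catC /= perm_cons.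
by rewrite perm_catC perm_sym => /IHs->.
Qed.

End Annihilators.

Section SetAnnihilators.
Variables (K : fieldType) (q : nat) (phi : {rmorphism K -> K}).
Hypothesis phiE : forall x, phi x = x ^+ q.
Hypothesis q_gt1 : (1 < q)%N.
Variables (I : finType) (alpha : I -> K).
Implicit Types (g : I -> K) (A B : {set I}).

Local Notation S := (skewX phi).

Definition annih_set g A : {poly K} := annih q phi alpha g (enum A).

Lemma size_annih_set g A : size (annih_set g A) = #|A|.+1.
Proof. by rewrite /annih_set (annih_monic_size _ _ _ g _).2 -cardE. Qed.

Lemma annih_set_neq0 g A : annih_set g A != 0.
Proof. by rewrite -size_poly_eq0 size_annih_set. Qed.

Lemma eq_annih_set g g' A : {in A, g =1 g'} -> annih_set g A = annih_set g' A.
Proof. by move=> eq_g; apply: eq_annih => j; rewrite mem_enum; apply: eq_g. Qed.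

Definition move_point g j y : {ffun I -> K} :=
  [ffun i => if i == j then y else g i].

Lemma move_pointE g j y : move_point g j y j = y.
Proof. by rewrite ffunE eqxx. Qed.

Lemma annih_set_move_point g j y A :
  j \notin A -> annih_set (move_point g j y) A = annih_set g A.
Proof.
move=> jA; apply: eq_annih_set => i iA; rewrite ffunE.
by case: eqP => // ij; rewrite -ij iA in jA.
Qed.

Lemma annih_set_root g A j :
  j \in A -> skew_eval phi (alpha j) (annih_set g A) (g j) = 0.
Proof. by move=> jA; rewrite annih_root ?mem_enum. Qed.

Lemma annih_setD1 g A j : j \in A -> let f := annih_set g (A :\ j) in
  annih_set g A = S f - conj_value q phi alpha g f j *: f.
Proof.
move=> jA f.
suff /(perm_annih phiE q_gt1) eq_annih : perm_eq (enum A) (j :: enum (A :\ j)).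
  exact: eq_annih.
apply: uniq_perm; rewrite /= ?enum_uniq ?mem_enum ?setD11 // => i.
by rewrite in_cons !mem_enum -in_setU1 setD1K.
Qed.

Lemma annih_set_subset g A B : B \subset A -> exists2 h : {poly K},
  (size h <= (#|A| - #|B|).+1)%N &
    annih_set g A = skew_mul phi h (annih_set g B).
Proof.
have [n] := ubnP #|A|; elim: n A => // n IHn A; rewrite ltnS => le_An sBA.
have [->|neqBA] := eqVneq B A.
  exists 1%:P; first by rewrite subnn size_polyC_leq1.
  by rewrite /skew_mul skew_actC scale1r.
have /properP[_ [j jA jB]] : B \proper A by rewrite properEneq neqBA.
have cardA := cardsD1 j A; rewrite jA in cardA.
have sBA' : B \subset A :\ j by rewrite subsetD1 sBA.
have [|h size_h fE] := IHn (A :\ j) _ sBA'; first by lia.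
have lt_size_h : (size h < (#|A| - #|B|).+1)%N.
  by have := subset_leq_card sBA'; lia.
exists (S h - conj_value q phi alpha g (annih_set g (A :\ j)) j *: h).
  apply: leq_trans (size_polyD _ _) _; rewrite size_polyN geq_max.
  apply/andP; split.
    exact: leq_trans (size_skewX_leq _ _) lt_size_h.
  exact: leq_trans (size_scale_leq _ _) (ltnW lt_size_h).
by rewrite (annih_setD1 _ jA) fE /skew_mul skew_actBl skew_actZl skew_act_skewX.
Qed.

End SetAnnihilators.

Section BaseChange.
Variables (F K : fieldType) (iota : {rmorphism F -> K}) (q : nat).
Variables (phiF : {rmorphism F -> F}) (phiK : {rmorphism K -> K}).
Hypothesis iota_phi : forall x, iota (phiF x) = phiK (iota x).

Lemma map_skew_eval a p y :
  iota (skew_eval phiF a p y) =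
  skew_eval phiK (iota a) (map_poly iota p) (iota y).
Proof.
rewrite /skew_eval /skew_act size_map_poly rmorph_sum; apply: eq_bigr => i _.
rewrite coef_map [LHS]rmorphM; congr (_ * _).
by elim: (val i) => //= n IHn; rewrite /sigma_op rmorphM iota_phi IHn.
Qed.

Lemma map_skewX p : map_poly iota (skewX phiF p) = skewX phiK (map_poly iota p).
Proof.
rewrite /skewX rmorphM /= map_polyX -!map_poly_comp; congr (_ * _).
by apply: eq_map_poly => x /=.
Qed.

Lemma map_annih_set (I : finType) (alpha g : I -> F) (A : {set I}) :
  map_poly iota (annih_set q phiF alpha g A) =
  annih_set q phiK (iota \o alpha) (iota \o g) A.
Proof.
rewrite /annih_set; elim: (enum A) => [|j s IHs] /=; first by rewrite rmorph1.
rewrite rmorphB /= map_polyZ /= map_skewX -IHs /conj_value rmorphM rmorphXn /=.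
by rewrite map_skew_eval.
Qed.

End BaseChange.

(** * Generic position *)

Section PolynomialFunctions.
Variables (K : fieldType) (I : finType).
Implicit Types (g d : {ffun I -> K}) (P : {ffun I -> K} -> K).

Definition line g d (t : K) : {ffun I -> K} := [ffun j => g j + t * d j].

(* Polynomiality is only needed on lines: two conditions that can each be
   satisfied are satisfied together on the line joining two witnesses. *)
Definition poly_on_lines P : Prop :=
  forall g d, exists h : {poly K}, forall t, P (line g d t) = h.[t].

Lemma eq_poly_on_lines P P' : P =1 P' -> poly_on_lines P -> poly_on_lines P'.
Proof.
move=> eqP polP g d; have [h hE] := polP g d.
by exists h => t; rewrite -eqP.
Qed.

Lemma poly_on_lines_const c : poly_on_lines (fun=> c).
Proof. by move=> g d; exists c%:P => t; rewrite hornerC. Qed.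

Lemma poly_on_lines_coord j : poly_on_lines (fun g => g j).
Proof.
by move=> g d; exists ((g j)%:P + 'X * (d j)%:P) => t; rewrite !ffunE !hornerE.
Qed.

Lemma poly_on_linesD P P' : poly_on_lines P -> poly_on_lines P' ->
  poly_on_lines (fun g => P g + P' g).
Proof.
move=> polP polP' g d; have [h hE] := polP g d; have [h' hE'] := polP' g d.
by exists (h + h') => t; rewrite hE hE' hornerD.
Qed.

Lemma poly_on_linesM P P' : poly_on_lines P -> poly_on_lines P' ->
  poly_on_lines (fun g => P g * P' g).
Proof.
move=> polP polP' g d; have [h hE] := polP g d; have [h' hE'] := polP' g d.
by exists (h * h') => t; rewrite hE hE' hornerM.
Qed.

Lemma poly_on_linesX P n : poly_on_lines P -> poly_on_lines (fun g => P g ^+ n).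
Proof.
move=> polP g d; have [h hE] := polP g d.
by exists (h ^+ n) => t; rewrite hE horner_exp.
Qed.

Lemma poly_on_lines_big op idx (J : Type) (s : seq J) (C : pred J)
    (P : J -> {ffun I -> K} -> K) :
    (forall P1 P2, poly_on_lines P1 -> poly_on_lines P2 ->
       poly_on_lines (fun g => op (P1 g) (P2 g))) ->
    (forall j, poly_on_lines (P j)) ->
  poly_on_lines (fun g => \big[op/idx]_(j <- s | C j) P j g).
Proof.
move=> pol_op polP; elim: s => [|j s IHs].
  by apply: eq_poly_on_lines (poly_on_lines_const idx) => g; rewrite big_nil.
case Cj: (C j); last first.
  by apply: eq_poly_on_lines IHs => g; rewrite big_cons Cj.
by apply: eq_poly_on_lines (pol_op _ _ (polP j) IHs) => g; rewrite big_cons Cj.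
Qed.

Lemma poly_on_lines_det n (M : {ffun I -> K} -> 'M[K]_n) :
  (forall i j, poly_on_lines (fun g => M g i j)) ->
  poly_on_lines (fun g => \det (M g)).
Proof.
move=> polM; apply: poly_on_lines_big => [|s]; first exact: poly_on_linesD.
apply: poly_on_linesM (poly_on_lines_const _) _.
by apply: poly_on_lines_big => //; apply: poly_on_linesM.
Qed.

End PolynomialFunctions.

Section GenericConditions.
Variables (K : fieldType) (I : finType).
Implicit Types (g : {ffun I -> K}) (Q : {ffun I -> K} -> Prop).

Definition infinite_field : Prop :=
  forall h : {poly K}, h != 0 -> exists x, ~~ root h x.

Definition generically Q : Prop :=
  exists P,
    [/\ poly_on_lines P, exists g, P g != 0 & forall g, P g != 0 -> Q g].

Lemma generically_exists Q : generically Q -> exists g, Q g.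
Proof. by case=> P [_ [g Pg] PQ]; exists g; apply: PQ. Qed.

Lemma generically_imp Q Q' :
  (forall g, Q g -> Q' g) -> generically Q -> generically Q'.
Proof. by move=> QQ' [P [polP ex PQ]]; exists P; split=> // g /PQ/QQ'. Qed.

Lemma generically_true Q : (forall g, Q g) -> generically Q.
Proof.
move=> allQ; exists (fun=> 1); split=> //; first exact: poly_on_lines_const.
by exists 0; apply: oner_neq0.
Qed.

Hypothesis Kinf : infinite_field.

Lemma generically_and Q Q' :
  generically Q -> generically Q' -> generically (fun g => Q g /\ Q' g).
Proof.
move=> [P [polP [g Pg] PQ]] [P' [polP' [g' Pg'] PQ']].
exists (fun x => P x * P' x); split; first exact: poly_on_linesM.
  have [h hE] := polP g (g' - g); have [h' hE'] := polP' g (g' - g).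
  have h_neq0 : h != 0.
    apply: contraNneq Pg => h0.
    suff <- : line g (g' - g) 0 = g by rewrite hE h0 horner0.
    by apply/ffunP => j; rewrite ffunE mul0r addr0.
  have h'_neq0 : h' != 0.
    apply: contraNneq Pg' => h0.
    suff <- : line g (g' - g) 1 = g' by rewrite hE' h0 horner0.
    by apply/ffunP => j; rewrite !ffunE mul1r addrC subrK.
  have [t] := Kinf (mulf_neq0 h_neq0 h'_neq0).
  rewrite /root hornerM -hE -hE' => PP'.
  by exists (line g (g' - g) t).
by move=> x; rewrite mulf_eq0 negb_or => /andP[/PQ ? /PQ'].
Qed.

Lemma generically_all (X : finType) (Q : X -> {ffun I -> K} -> Prop) :
  (forall x, generically (Q x)) -> generically (fun g => forall x, Q x g).
Proof.
move=> genQ.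
suff /generically_imp : generically (fun g => forall x, x \in enum X -> Q x g).
  by apply=> g allQ x; apply: allQ; rewrite mem_enum.
elim: (enum X) => [|x s IHs]; first exact: generically_true.
apply: generically_imp (generically_and (genQ x) IHs) => g [Qx allQ] y.
by rewrite inE => /predU1P[->|/allQ].
Qed.

Lemma generically_row_free m n (M : {ffun I -> K} -> 'M[K]_(m, n)) :
    (forall i j, poly_on_lines (fun g => M g i j)) ->
    (exists g, row_free (M g)) ->
  generically (fun g => row_free (M g)).
Proof.
move=> polM [g0 /row_freeP[B MB1]]; exists (fun g => \det (M g *m B)); split.
- apply: poly_on_lines_det => i j.
  apply: (eq_poly_on_lines (P := fun g => \sum_l M g i l * B l j)) => [g|].
    by rewrite mxE.
  apply: poly_on_lines_big => [|l]; first exact: poly_on_linesD.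
  apply: poly_on_linesM => /=; first exact: polM.
  exact: poly_on_lines_const.
- by exists g0; rewrite MB1 det1 oner_neq0.
move=> g; rewrite -unitfE -/(_ \in unitmx) => MBunit; apply/row_freeP.
by exists (B *m invmx (M g *m B)); rewrite mulmxA mulmxV.
Qed.

End GenericConditions.

Section GenericAnnihilators.
Variables (K : fieldType) (q : nat) (phi : {rmorphism K -> K}).
Hypothesis phiE : forall x, phi x = x ^+ q.
Hypothesis q_gt1 : (1 < q)%N.
Hypothesis Kinf : infinite_field K.
Variables (I : finType) (alpha : I -> K).
Hypothesis alpha_neq0 : forall j, alpha j != 0.
Implicit Types (f : {ffun I -> K} -> {poly K}) (A : {set I}).

Local Notation S := (skewX phi).
Local Notation ann := (annih_set q phi alpha).

Definition poly_coefs f : Prop := forall i, poly_on_lines (fun g => (f g)`_i).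

Lemma poly_coefs_skewX f : poly_coefs f -> poly_coefs (fun g => S (f g)).
Proof.
move=> polf [|i].
  by apply: eq_poly_on_lines (poly_on_lines_const 0) => g; rewrite coef_skewX.
apply: eq_poly_on_lines (poly_on_linesX q (polf i)) => g.
by rewrite coef_skewX phiE.
Qed.

Lemma poly_coefs_iter_skewX n f :
  poly_coefs f -> poly_coefs (fun g => iter n S (f g)).
Proof. by move=> polf; elim: n => //= n IHn; apply: poly_coefs_skewX. Qed.

Lemma poly_on_lines_skew_eval a f j N :
  poly_coefs f -> (forall g, size (f g) <= N)%N ->
  poly_on_lines (fun g => skew_eval phi a (f g) (g j)).
Proof.
move=> polf size_f; pose term (i : 'I_N) (g : {ffun I -> K}) :=
  (f g)`_i * (iter i (sigma_op phi a) 1 * g j ^+ (q ^ i)).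
apply: (eq_poly_on_lines (P := fun g => \sum_i term i g)) => [g|].
  by rewrite (skew_evalE phiE _ _ (size_f g)).
apply: poly_on_lines_big => [|i]; first exact: poly_on_linesD.
apply: poly_on_linesM (polf i) _.
apply: poly_on_linesM (poly_on_lines_const _) _.
exact/poly_on_linesX/poly_on_lines_coord.
Qed.

Lemma poly_coefs_annih_set A : poly_coefs (fun g => ann g A).
Proof.
rewrite /annih_set; elim: (enum A) => [|j s IHs] i /=.
  exact: poly_on_lines_const.
have pol_ev := poly_on_lines_skew_eval (alpha j) j IHs
  (fun g => eq_leq (annih_monic_size q phi alpha g s).2).
have pol_conj := poly_on_linesM (poly_on_lines_const (- alpha j))
  (poly_on_linesX (q - 1) pol_ev).
apply: eq_poly_on_lines (poly_on_linesD (poly_coefs_skewX IHs i)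
  (poly_on_linesM pol_conj (IHs i))) => g.
by rewrite coefB coefZ /conj_value !mulNr.
Qed.

Lemma generically_annih_set_coef0 A : generically (fun g => (ann g A)`_0 != 0).
Proof.
exists (fun g => (ann g A)`_0); split=> //; first exact: poly_coefs_annih_set.
have [n] := ubnP #|A|; elim: n A => // n IHn A; rewrite ltnS => le_An.
have [->|[j jA]] := set_0Vmem A.
  by exists 0; rewrite /annih_set enum_set0 coef1 oner_neq0.
have cardA := cardsD1 j A; rewrite jA in cardA.
have [|g g_coef0] := IHn (A :\ j); first by lia.
have [y] := Kinf (linearized_poly_neq0 phi q_gt1 (alpha_neq0 j)
  (annih_set_neq0 q phi alpha g (A :\ j))).
rewrite /root (horner_linearized_poly phiE) => ev_y.
exists (move_point g j y).
rewrite (annih_setD1 phiE q_gt1 _ _ jA) /= annih_set_move_point ?setD11 //.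
rewrite coefB coef_skewX sub0r oppr_eq0 coefZ mulf_neq0 //.
by rewrite /conj_value move_pointE mulf_neq0 ?expf_neq0.
Qed.

End GenericAnnihilators.

(** * Independence under skew multipliers of bounded degree *)

Section SkewIndependence.
Variables (K : fieldType) (phi : {rmorphism K -> K}) (r : nat).
Implicit Types (h p : {poly K}) (d t : 'I_r -> nat) (f c : 'I_r -> {poly K}).

Local Notation S := (skewX phi).
Local Notation mul := (skew_mul phi).

Definition skew_indep d f : Prop := forall c, (forall i, size (c i) <= d i)%N ->
  \sum_i mul (c i) (f i) = 0 -> forall i, c i = 0.

Definition skew_mx N d f : 'M[K]_(\sum_i d i, N) :=
  \mxcol_i \matrix_(e < d i) poly_rV (iter e S (f i)).

Lemma mul_rV_skew_rows m N (u : 'rV_m) p :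
  u *m (\matrix_(e < m) poly_rV (iter e S p)) =
  poly_rV (mul (rVpoly u) p) :> 'rV_N.
Proof.
rewrite mulmx_sum_row /skew_mul (skew_act_widen _ _ (size_poly _ _)) linear_sum.
by apply: eq_bigr => e _; rewrite rowK linearZ coef_rVpoly_ord.
Qed.

Lemma mul_skew_mx N d f (v : 'rV_(\sum_i d i)) :
  v *m skew_mx N d f = poly_rV (\sum_i mul (rVpoly (submxrow v i)) (f i)).
Proof.
rewrite -{1}(submxrowK v) mul_mxrow_mxcol linear_sum.
by apply: eq_bigr => i _; rewrite mul_rV_skew_rows.
Qed.

Lemma skew_indepP N d f : (forall i, 0 < d i -> size (f i) + d i <= N.+1)%N ->
  skew_indep d f <-> row_free (skew_mx N d f).
Proof.
move=> size_f.
have size_sum c : (forall i, size (c i) <= d i)%N ->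
    (size (\sum_i mul (c i) (f i))%R <= N)%N.
  move=> size_c; apply: leq_trans (size_sum _ _ _) _; apply/bigmax_leqP => i _.
  have [di0|d_gt0] := posnP (d i).
    have := size_c i; rewrite di0 leqn0 size_poly_eq0 => /eqP->.
    by rewrite /skew_mul skew_act0l size_poly0.
  apply/size_skew_mul_leq/(leq_trans _ (size_f i d_gt0)).
  by rewrite addnC leq_add2l.
split=> [indep|/row_free_inj free c size_c sum0 i].
  apply: inj_row_free => v; rewrite mul_skew_mx => /(congr1 rVpoly).
  rewrite linear0 poly_rV_K; last by apply: size_sum => i; apply: size_poly.
  move/indep => v0; rewrite -[v]submxrowK -[RHS]mxrow0; apply: eq_mxrow => i.
  by apply: (can_inj rVpolyK); rewrite linear0 v0 // => j; apply: size_poly.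
pose v := \mxrow_j (poly_rV (c j) : 'rV_(d j)).
have vK j : rVpoly (submxrow v j) = c j by rewrite mxrowK poly_rV_K.
have /free v0 : v *m skew_mx N d f = 0 *m skew_mx N d f.
  rewrite mul0mx mul_skew_mx; under eq_bigr do rewrite vK.
  by rewrite sum0 linear0.
by rewrite -vK v0 submxrow0 linear0.
Qed.

Lemma iter_skewX_map n p :
  iter n S (map_poly phi p) = map_poly phi (iter n S p).
Proof. by elim: n => //= n ->; rewrite /skewX rmorphM /= map_polyX. Qed.

Lemma skew_mx_map N d f :
  skew_mx N d (map_poly phi \o f) = map_mx phi (skew_mx N d f).
Proof. by apply/matrixP => i j; rewrite !mxE /= iter_skewX_map coef_map. Qed.

Lemma skew_indep_map d f : skew_indep d f -> skew_indep d (map_poly phi \o f).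
Proof.
pose N := (\max_i (size (f i) + d i))%N.
have size_f i : (0 < d i -> size (f i) + d i <= N.+1)%N.
  by move=> _; apply: leq_trans (leq_bigmax_cond _ _) (leqnSn _).
move=> /(skew_indepP size_f) free; apply/(@skew_indepP N) => [i|].
  by rewrite /= size_map_poly; apply: size_f.
by rewrite skew_mx_map row_free_map.
Qed.

Lemma skew_mulMX h p : mul h ('X * p) = 'X * mul h p.
Proof.
have iterM n : iter n S ('X * p) = 'X * iter n S p.
  by elim: n => //= n ->; rewrite /skewX rmorphM /= map_polyX mulrCA.
rewrite /skew_mul /skew_act mulr_sumr; apply: eq_bigr => i _.
by rewrite iterM scalerAr.
Qed.

Lemma skew_indep_skewX d f : skew_indep d f -> skew_indep d (S \o f).
Proof.
move=> /skew_indep_map indep c size_c sum0; apply: indep size_c _.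
apply: (mulfI (negbT (polyX_eq0 K))); rewrite mulr0 mulr_sumr -[RHS]sum0.
by apply: eq_bigr => i _; rewrite -skew_mulMX.
Qed.

Lemma skew_indep_cancelX d t f :
    (forall i, (0 < d i)%N -> t i = 0%N -> (f i)`_0 != 0) ->
    (forall i j, 0 < d i -> 0 < d j -> t i = 0 -> t j = 0 -> i = j)%N ->
    skew_indep (fun i => d i - (t i == 0))%N (fun i => iter (t i).-1 S (f i)) ->
  skew_indep d (fun i => iter (t i) S (f i)).
Proof.
move=> f_coef0 uniq_t0 indep c size_c sum0.
have c_inactive i : d i = 0%N -> c i = 0.
  by move=> di; apply/eqP; rewrite -size_poly_leq0 -di.
have c_coef0 i : t i = 0%N -> (c i)`_0 = 0.
  move=> ti; have [/c_inactive->|di] := posnP (d i); first by rewrite coef0.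
  have := congr1 (fun p : {poly K} => p`_0) sum0.
  rewrite coef0 coef_sum (bigD1 i) //= big1 ?addr0 => [/eqP|j ij].
    rewrite coef0_skew_mul ti mulf_eq0 (negPf (f_coef0 i di ti)) orbF.
    by move/eqP.
  rewrite coef0_skew_mul.
  case tj: (t j) => [|n]; last by rewrite coef_skewX mulr0.
  have [/c_inactive->|dj] := posnP (d j); first by rewrite coef0 mul0r.
  by rewrite (uniq_t0 j i) ?eqxx in ij.
pose c' i := drop_poly (t i == 0)%N (c i).
have cE i : c i = c' i * 'X^(t i == 0)%N.
  rewrite -[LHS](poly_take_drop (t i == 0)%N) -/(c' i) -[RHS]add0r.
  congr (_ + _).
  apply/polyP => -[|n]; rewrite coef_take_poly coef0; case: eqP => //.
  exact: c_coef0.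
suff c'0 i : c' i = 0 by move=> i; rewrite cE c'0 mul0r.
apply: (skew_indep_skewX indep) i => [i|].
  by rewrite size_drop_poly leq_sub2r.
rewrite -[RHS]sum0; apply: eq_bigr => i _; rewrite cE /=.
have [ti|ti] := eqVneq (t i) 0%N; first by rewrite ti expr1 [RHS]skew_actMX.
by rewrite expr0 mulr1 -iterS prednK ?lt0n.
Qed.

Lemma skew_indep_merge (O : {set 'I_r}) i0 D p d f (h : 'I_r -> {poly K}) :
    i0 \in O -> (forall i, i \in O -> f i = mul (h i) p) ->
    (forall i, i \in O -> size (h i) + d i <= D.+1)%N ->
    skew_indep (fun i => if i \in O then d i else 0)%N f ->
    skew_indep (fun i => if i == i0 then D else if i \in O then 0 else d i)%N
      [eta f with i0 |-> p] ->
  skew_indep d f.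
Proof.
move=> i0O fE size_h indepO indep_merged c size_c sum0.
pose cO := \sum_(i in O) mul (c i) (h i).
have sumO : \sum_(i in O) mul (c i) (f i) = mul cO p.
  by rewrite [RHS]skew_act_suml; apply: eq_bigr => i /fE->; rewrite skew_mulA.
have size_cO : (size cO <= D)%N.
  apply: leq_trans (size_sum _ _ _) _; apply/bigmax_leqP => i iO.
  apply/size_skew_mul_leq/(leq_trans _ (size_h i iO)).
  by rewrite addnC leq_add2l.
pose c_merged i := if i == i0 then cO else if i \in O then 0 else c i.
have c_merged0 : forall i, c_merged i = 0.
  apply: indep_merged => [i|].
    by rewrite /c_merged; case: eqP => // _; case: ifP; rewrite ?size_poly0.
  rewrite -[RHS]sum0 [RHS](bigID (mem O)) /= sumO (bigID (mem O)) /=.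
  congr (_ + _).
    rewrite (bigD1 i0) //= /c_merged eqxx big1 ?addr0 // => i.
    by case/andP=> iO /negPf->; rewrite iO [LHS]skew_act0l.
  apply: eq_bigr => i iO.
  have /negPf ne_i0 : i != i0 by apply: contraNneq iO => ->.
  by rewrite /c_merged ne_i0 (negPf iO).
have cO0 : cO = 0 by have := c_merged0 i0; rewrite /c_merged eqxx.
have c_out i : i \notin O -> c i = 0.
  move=> iO; have := c_merged0 i; rewrite /c_merged (negPf iO).
  by case: eqP => // ii0; rewrite ii0 i0O in iO.
move=> i; have [iO|/c_out//] := boolP (i \in O).
have := indepO (fun i => if i \in O then c i else 0) _ _ i.
rewrite iO; apply=> [j|]; first by case: ifP; rewrite ?size_poly0.
transitivity (\sum_(j in O) mul (c j) (f j)).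
  rewrite [RHS]big_mkcond; apply: eq_bigr => j _.
  by case: ifP => // _; rewrite [LHS]skew_act0l.
by rewrite sumO cO0 [LHS]skew_act0l.
Qed.

End SkewIndependence.

(** * Zero patterns *)

Section Patterns.
Variables (I : finType) (r : nat).
Implicit Types (A B : {set I}) (O : {set 'I_r}).

(* The pattern stands for the family of all [X^(shift i + e) f_i] with
   [e < mult i], where [f_i] annihilates the points indexed by [zeros i]. *)
Record pattern := Pattern {
  zeros : 'I_r -> {set I};
  shift : 'I_r -> nat;
  mult : 'I_r -> nat }.

Implicit Type P : pattern.

Definition active P : {set 'I_r} := [set i | 0 < mult P i]%N.

Definition common_factor P O B t : bool :=
  [forall i in O, (B \subset zeros P i) && (t <= shift P i)%N].

Record admissible k P : Prop := Admissible {
  active_degree : forall i, i \in active P ->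
    (#|zeros P i| + shift P i + mult P i = k)%N;
  common_factor_leq : forall O B t, O \subset active P -> O != set0 ->
    common_factor P O B t -> (\sum_(i in O) mult P i + #|B| + t <= k)%N }.

Definition tight k P O B t : bool :=
  [&& O \proper active P, (1 < #|O|)%N, common_factor P O B t
    & \sum_(i in O) mult P i + #|B| + t == k]%N.

Definition restrict_rows O P : pattern :=
  Pattern (zeros P) (shift P) (fun i => if i \in O then mult P i else 0%N).

Definition merge_rows O i0 B t P : pattern :=
  Pattern [eta zeros P with i0 |-> B] [eta shift P with i0 |-> t]
    (fun i => if i == i0 then (\sum_(j in O) mult P j)%N
              else if i \in O then 0%N else mult P i).

Definition cancelX P : pattern :=
  Pattern (zeros P) (fun i => (shift P i).-1)
    (fun i => mult P i - (shift P i == 0))%N.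

Definition vanish_at j P : pattern :=
  Pattern (fun i => zeros P i :\ j)
    (fun i => shift P i + (j \in zeros P i))%N (mult P).

Definition unique_unshifted P : Prop :=
  forall i j, i \in active P -> j \in active P ->
    shift P i = 0%N -> shift P j = 0%N -> i = j.

Lemma exists_tight_or_none k P :
  (exists O B t, tight k P O B t) \/ (forall O B t, ~~ tight k P O B t).
Proof.
have [/existsP[O /existsP[B /existsP[t tightO]]]|none] :=
    boolP [exists O, exists B, exists t : 'I_k.+1, tight k P O B t].
  by left; exists O, B, t.
right=> O B t; apply: contra none => tightO.
have /and4P[_ _ _ /eqP sumE] := tightO.
have t_ltk : (t < k.+1)%N by lia.
apply/existsP; exists O; apply/existsP; exists B.
by apply/existsP; exists (Ordinal t_ltk).
Qed.

Lemma exists_unshifted_pair_or_unique P :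
  (exists i0 i1, [/\ i0 \in active P, i1 \in active P, i0 != i1,
     shift P i0 = 0%N & shift P i1 = 0%N]) \/ unique_unshifted P.
Proof.
have [/exists_inP[i0 i0P /exists_inP[i1 i1P]]|none] :=
    boolP [exists i0 in active P, exists i1 in active P,
      [&& i0 != i1, shift P i0 == 0 & shift P i1 == 0]]%N.
  by move=> /and3P[ne_i /eqP shift0 /eqP shift1]; left; exists i0, i1.
right=> i0 i1 i0P i1P shift0 shift1; apply: contraNeq none => ne_i.
apply/exists_inP; exists i0 => //; apply/exists_inP; exists i1 => //.
by rewrite ne_i shift0 shift1.
Qed.

Lemma common_factorP P O B t i :
  common_factor P O B t -> i \in O ->
  (B \subset zeros P i) /\ (t <= shift P i)%N.
Proof. by move=> /forall_inP cf /cf /andP. Qed.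

Lemma active_restrict O P : active (restrict_rows O P) \subset O :&: active P.
Proof. by apply/subsetP => i; rewrite !inE /=; case: ifP. Qed.

Lemma admissible_restrict k O P :
  admissible k P -> admissible k (restrict_rows O P).
Proof.
move=> adm; have subO := subsetP (active_restrict O P).
split=> [i /[dup] /subO /setIP[iO iP] _|O' B t sO' O'0 cf].
  by rewrite /= iO; apply: active_degree adm _ iP.
have {subO} sO' : O' \subset O :&: active P.
  exact: subset_trans sO' (active_restrict O P).
have -> : (\sum_(i in O') mult (restrict_rows O P) i =
           \sum_(i in O') mult P i)%N.
  by apply: eq_bigr => i /(subsetP sO')/setIP[iO _] /=; rewrite iO.
apply: common_factor_leq adm _ _ _ _ O'0 cf.
exact: subset_trans sO' (subsetIr _ _).
Qed.

Section Merge.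
Variables (k : nat) (O : {set 'I_r}) (i0 : 'I_r) (B : {set I}) (t : nat).
Variable P : pattern.
Hypotheses (adm : admissible k P) (tightO : tight k P O B t) (i0O : i0 \in O).

Local Notation merged := (merge_rows O i0 B t P).

Definition unmerge (O' : {set 'I_r}) : {set 'I_r} :=
  if i0 \in O' then O :|: O' else O'.

Let sOP : O \subset active P. Proof. by case/and4P: tightO => /proper_sub. Qed.

Let cfO : common_factor P O B t. Proof. by case/and4P: tightO. Qed.

Lemma active_merge i : i \in active merged -> i != i0 -> i \in active P :\: O.
Proof. by move=> + /negPf ne_i0; rewrite !inE /= ne_i0; case: ifP. Qed.

Lemma active_unmerge O' :
  O' \subset active merged -> unmerge O' \subset active P.
Proof.
move=> sO'; have sub i : i \in O' -> i \in active P.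
  move=> iO'; have [->|ne_i0] := eqVneq i i0; first exact: (subsetP sOP).
  by case/setDP: (active_merge (subsetP sO' i iO') ne_i0).
by rewrite /unmerge; case: ifP => _; rewrite ?subUset ?sOP /=; apply/subsetP.
Qed.

Lemma common_factor_unmerge O' B' t' :
  common_factor merged O' B' t' -> common_factor P (unmerge O') B' t'.
Proof.
move=> cf; have on_O i : i0 \in O' -> i \in O ->
    (B' \subset zeros P i) && (t' <= shift P i)%N.
  move=> /(common_factorP cf) /=; rewrite eqxx => -[sB'B le_t't] iO.
  have [sBZ le_t] := common_factorP cfO iO.
  by rewrite (subset_trans sB'B sBZ) (leq_trans le_t't le_t).
have on_O' i : i \in O' -> (B' \subset zeros P i) && (t' <= shift P i)%N.
  move=> iO'; have [ii0|/negPf ne_i0] := eqVneq i i0.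
    by rewrite on_O // ?ii0 // -ii0.
  by have /= := common_factorP cf iO'; rewrite ne_i0 => -[-> ->].
apply/forall_inP => i; rewrite /unmerge; case: ifP => [i0O'|_ /on_O' //].
by case/setUP => [/on_O->|/on_O'].
Qed.

Lemma sum_mult_unmerge O' : O' \subset active merged ->
  (\sum_(i in O') mult merged i = \sum_(i in unmerge O') mult P i)%N.
Proof.
move=> sO'; have out i : i \in O' -> i != i0 -> i \notin O.
  by move=> iO' ne_i0; case/setDP: (active_merge (subsetP sO' i iO') ne_i0).
have multE i : i \in O' -> i != i0 -> mult merged i = mult P i.
  by move=> iO' ne_i0; rewrite /= (negPf ne_i0) (negPf (out i iO' ne_i0)).
rewrite /unmerge; case: ifP => [i0O'|/negP i0O']; last first.
  apply: eq_bigr => i iO'; apply: multE => //.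
  by apply: contra_notN i0O' => /eqP<-.
rewrite (big_setD1 i0 i0O') [RHS](big_setID O) setUK /= eqxx; congr (_ + _)%N.
apply: eq_big => [i|i /setD1P[ne_i0 iO']]; last exact: multE.
rewrite !inE; have [->|ne_i0] /= := eqVneq i i0; first by rewrite i0O.
by case: (boolP (i \in O)) => //= iO; apply: contraTF iO => iO'; apply: out.
Qed.

Lemma admissible_merge : admissible k merged.
Proof.
split=> [i iP|O' B' t' sO' O'0 cf].
  have [->|ne_i0] := eqVneq i i0.
    by case/and4P: tightO => _ _ _ /eqP <-; rewrite /= eqxx addnC addnA.
  have /setDP[iP' iO] := active_merge iP ne_i0.
  by rewrite /= (negPf ne_i0) (negPf iO) (active_degree adm iP').
rewrite sum_mult_unmerge //; apply: common_factor_leq adm _ _ _ _ _ _.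
- exact: active_unmerge.
- have [i iO'] := set0Pn _ O'0; apply/set0Pn; exists i.
  by rewrite /unmerge; case: ifP => // _; rewrite inE iO' orbT.
exact: common_factor_unmerge.
Qed.

End Merge.

Lemma admissible_cancelX k P :
  admissible k P -> unique_unshifted P -> admissible k.-1 (cancelX P).
Proof.
move=> adm uniq_shift0.
have activeW i : i \in active (cancelX P) -> i \in active P.
  by rewrite !inE /=; lia.
split=> [i iX|O B t sO O0 cf].
  have := active_degree adm (activeW i iX); move: iX; rewrite !inE /=.
  by case: (shift P i) => [|n] /=; lia.
have {}sO : O \subset active P by apply/subsetP => i /(subsetP sO)/activeW.
have [/exists_inP[i0 i0O /eqP shift_i0]|no_shift0] :=
    boolP [exists i in O, shift P i == 0%N].
  have /= [_] := common_factorP cf i0O; rewrite shift_i0 leqn0 => /eqP->.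
  have i0P : (0 < mult P i0)%N by have := subsetP sO i0 i0O; rewrite inE.
  have sumE : (\sum_(i in O :\ i0) mult (cancelX P) i =
               \sum_(i in O :\ i0) mult P i)%N.
    apply: eq_bigr => i /setD1P[ne_i0 iO] /=.
    case: eqP => [shift_i|_]; last by rewrite subn0.
    by rewrite (uniq_shift0 i i0) ?eqxx ?(subsetP sO) in ne_i0.
  have : (\sum_(i in O) mult P i + #|B| + 0 <= k)%N.
    apply: common_factor_leq adm _ _ _ sO O0 _.
    by apply/forall_inP => i /(common_factorP cf)[->].
  rewrite !(big_setD1 i0 i0O) /= sumE shift_i0 eqxx.
  by set rest := (\sum_(i in _) _)%N; lia.
have shift_gt0 i : i \in O -> (0 < shift P i)%N.
  move=> iO; rewrite lt0n; apply: contra no_shift0 => shift_i.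
  by apply/exists_inP; exists i.
have : (\sum_(i in O) mult P i + #|B| + t.+1 <= k)%N.
  apply: common_factor_leq adm _ _ _ sO O0 _; apply/forall_inP => i iO.
  have /= [-> le_t] := common_factorP cf iO.
  by have := shift_gt0 i iO; rewrite /=; lia.
have -> : (\sum_(i in O) mult (cancelX P) i = \sum_(i in O) mult P i)%N.
  by apply: eq_bigr => i iO; rewrite /= -leqn0 leqNgt shift_gt0 // subn0.
by set total := (\sum_(i in _) _)%N; lia.
Qed.

Lemma admissible_vanish k j i0 P : admissible k P ->
    (forall O B t, ~~ tight k P O B t) ->
    i0 \in active P -> shift P i0 = 0%N -> j \notin zeros P i0 ->
  admissible k (vanish_at j P).
Proof.
move=> adm not_tight i0P shift_i0 j_i0; split=> [i iP|O B t sO O0 cf].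
  by have := active_degree adm iP; rewrite (cardsD1 j (zeros P i)) /=; lia.
have sBZ i : i \in O -> B \subset zeros P i.
  by move=> /(common_factorP cf)[/= /subset_trans-> //]; rewrite subsetDl.
have cf_pred : common_factor P O B t.-1.
  apply/forall_inP => i iO; rewrite sBZ //=.
  have /= [_ le_t] := common_factorP cf iO.
  by rewrite -subn1 leq_subLR addnC (leq_trans le_t) // leq_add2l leq_b1.
have [t0|t_gt0] := posnP t.
  by move: (common_factor_leq adm sO O0 cf_pred); rewrite t0.
have [all_j|] := boolP [forall i in O, j \in zeros P i].
  have jB : j \notin B.
    have [i iO] := set0Pn _ O0; have /= [/subsetP sB _] := common_factorP cf iO.
    by apply/negP => /sB; rewrite setD11.
  have cf_j : common_factor P O (j |: B) t.-1.
    apply/forall_inP => i iO; have [sB le_t] := common_factorP cf_pred iO.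
    by rewrite subUset sub1set (forall_inP all_j) // sB.
  have := common_factor_leq adm sO O0 cf_j.
  by rewrite cardsU1 jB add1n addnS addSnnS prednK.
rewrite negb_forall_in => /exists_inP[i1 i1O j_i1].
have [O_le1|O_gt1] := leqP #|O| 1.
  have OE : O = [set i1].
    by apply/esym/eqP; rewrite eqEcard sub1set i1O cards1.
  apply: common_factor_leq adm _ _ _ sO O0 _; apply/forall_inP => i iO.
  rewrite sBZ //=; have /= [_] := common_factorP cf iO.
  by move: iO; rewrite OE => /set1P->; rewrite (negPf j_i1) addn0.
have O_proper : O \proper active P.
  rewrite properEneq sO andbT; apply: contraTneq t_gt0 => OE; rewrite -leqNgt.
  have /= [|_] := common_factorP cf (i := i0); first by rewrite OE.
  by rewrite shift_i0 (negPf j_i0).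
have := common_factor_leq adm sO O0 cf_pred; rewrite leq_eqVlt.
have := not_tight O B t.-1.
by rewrite /tight O_proper O_gt1 cf_pred /= => /negPf->; lia.
Qed.

Definition weight k P : nat := (#|active P| + k + \sum_i #|zeros P i|)%N.

Lemma weight_restrict k O P :
  O \proper active P -> (weight k (restrict_rows O P) < weight k P)%N.
Proof.
move=> /proper_card lt_O; rewrite !ltn_add2r.
apply: leq_ltn_trans lt_O; apply/subset_leq_card.
by apply: subset_trans (active_restrict O P) (subsetIl _ _).
Qed.

Lemma weight_merge k O i0 B t P : tight k P O B t -> i0 \in O ->
  (weight k (merge_rows O i0 B t P) < weight k P)%N.
Proof.
move=> /and4P[/proper_sub sOP O_gt1 cf _] i0O.
rewrite -addSn leq_add //; last first.
  apply: leq_sum => i _ /=; case: eqP => // ->.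
  by have [sBZ _] := common_factorP cf i0O; apply: subset_leq_card.
rewrite ltn_add2r (@leq_ltn_trans #|i0 |: active P :\: O|) //.
  apply/subset_leq_card/subsetP => i iP; rewrite in_setU1.
  by have [//|ne_i0] := eqVneq i i0; apply: active_merge iP ne_i0.
rewrite cardsU1 inE i0O cardsD (setIidPr sOP).
by have := subset_leq_card sOP; lia.
Qed.

Lemma weight_cancelX k P :
  (0 < k)%N -> (weight k.-1 (cancelX P) < weight k P)%N.
Proof.
move=> k_gt0; rewrite ltn_add2r -addnS prednK // leq_add2r.
by apply/subset_leq_card/subsetP => i; rewrite !inE /=; lia.
Qed.

Lemma weight_vanish k j i P :
  j \in zeros P i -> (weight k (vanish_at j P) < weight k P)%N.
Proof.
move=> ji; rewrite ltn_add2l (bigD1 i) //= [X in (_ < X)%N](bigD1 i) //=.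
rewrite [X in (_ < X + _)%N](cardsD1 j) ji ltnS leq_add2l.
by apply: leq_sum => l _; apply/subset_leq_card/subsetDl.
Qed.

End Patterns.

(** * Generic independence of annihilators *)

Section GenericIndependence.
Variables (K : fieldType) (q : nat) (phi : {rmorphism K -> K}).
Hypothesis phiE : forall x, phi x = x ^+ q.
Hypothesis q_gt1 : (1 < q)%N.
Hypothesis Kinf : infinite_field K.
Variables (I : finType) (alpha : I -> K) (r : nat).
Hypothesis alpha_neq0 : forall j, alpha j != 0.
Implicit Types (P : pattern I r) (g : {ffun I -> K}).

Local Notation S := (skewX phi).
Local Notation ann := (annih_set q phi alpha).

Definition pattern_row P g i : {poly K} :=
  iter (shift P i) S (ann g (zeros P i)).

Definition pattern_indep P g : Prop :=
  skew_indep phi (mult P) (pattern_row P g).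

Lemma generically_pattern_indep P :
  (exists g, pattern_indep P g) -> generically (pattern_indep P).
Proof.
pose N := (\max_i (#|zeros P i|.+1 + shift P i + mult P i))%N.
have indepP g : pattern_indep P g <->
    row_free (skew_mx phi N (mult P) (pattern_row P g)).
  apply: skew_indepP => i _; apply: leq_trans (leqnSn _).
  apply: (bigmax_sup i) => //.
  by rewrite leq_add2r (leq_trans (size_iter_skewX _ _ _)) // size_annih_set.
case=> g /indepP free; apply: generically_imp (fun g => (indepP g).2) _.
apply: generically_row_free => [i j|]; last by exists g.
pose row_i := tagnat.sig1 i; have /(_ j) := poly_coefs_iter_skewX phiE
  (tagnat.sig2 i + shift P row_i)
  (poly_coefs_annih_set phiE alpha (zeros P row_i)).
by apply: eq_poly_on_lines => g'; rewrite !mxE iterD.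
Qed.

Lemma pattern_indep_inactive P g : active P = set0 -> pattern_indep P g.
Proof.
move=> P0 c size_c _ i; apply/eqP.
rewrite -size_poly_leq0 (leq_trans (size_c i)) //.
by have := in_set0 i; rewrite -P0 inE => /negbT; rewrite -leqNgt.
Qed.

Lemma pattern_indep_merge k O i0 B t P g :
    admissible k P -> tight k P O B t -> i0 \in O ->
    pattern_indep (restrict_rows O P) g ->
    pattern_indep (merge_rows O i0 B t P) g ->
  pattern_indep P g.
Proof.
move=> adm /and4P[/proper_sub sOP _ cf /eqP tightO] i0O indepO indepM.
pose D := (\sum_(i in O) mult P i)%N; pose p := iter t S (ann g B).
have /fin_all_exists[h hP] (i : 'I_r) : exists h : {poly K}, i \in O ->
    pattern_row P g i = skew_mul phi h p /\ (size h + mult P i <= D.+1)%N.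
  have [iO|] := boolP (i \in O); last by exists 0.
  have [sBZ le_t] := common_factorP cf iO.
  have [h0 size_h0 annE] := annih_set_subset phiE q_gt1 alpha g sBZ.
  have [h size_h rowE] := iter_skewX_mul phi h0 (ann g B) le_t.
  exists h => _; split; first by rewrite /pattern_row annE rowE.
  pose size_bound := ((#|zeros P i| - #|B|).+1 + (shift P i - t))%N.
  rewrite (@leq_trans (size_bound + mult P i)) //.
    by rewrite leq_add2r (leq_trans size_h) // leq_add2r.
  have := active_degree adm (subsetP sOP i iO); have := subset_leq_card sBZ.
  by move: tightO; rewrite -/D /size_bound; lia.
apply: (skew_indep_merge (O := O) (i0 := i0) (D := D) (p := p) (h := h)) => //.
- by move=> i /hP[].
- by move=> i /hP[].
move=> c size_c sum0; apply: indepM => //.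
rewrite -[RHS]sum0; apply: eq_bigr => i _.
by rewrite /pattern_row /=; case: eqP.
Qed.

Lemma pattern_indep_cancelX P g :
  (forall i, (ann g (zeros P i))`_0 != 0) -> unique_unshifted P ->
  pattern_indep (cancelX P) g -> pattern_indep P g.
Proof.
move=> ann_coef0 uniq_shift0 indep.
apply: skew_indep_cancelX indep => [i _ _|i j di dj].
  exact: ann_coef0.
by apply: uniq_shift0; rewrite inE.
Qed.

Lemma pattern_row_vanish j P g i :
  pattern_row P (move_point g j 0) i = pattern_row (vanish_at j P) g i.
Proof.
rewrite /pattern_row /=; have [jZ|jZ] := boolP (j \in zeros P i); last first.
  rewrite addn0 annih_set_move_point // (setDidPl _) //.
  by rewrite disjoint_sym disjoints1.
rewrite (annih_setD1 phiE q_gt1 _ _ jZ) conj_value0 ?move_pointE //.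
by rewrite scale0r subr0 -iterSr addn1 annih_set_move_point // setD11.
Qed.

Lemma pattern_indep_vanish j P :
  (exists g, pattern_indep (vanish_at j P) g) -> exists g, pattern_indep P g.
Proof.
case=> g indep; exists (move_point g j 0) => c size_c sum0; apply: indep => //.
by rewrite -[RHS]sum0; apply: eq_bigr => i _; rewrite pattern_row_vanish.
Qed.

Lemma exists_separating_zero k P i0 i1 : admissible k P -> i0 != i1 ->
    i0 \in active P -> i1 \in active P ->
    shift P i0 = 0%N -> shift P i1 = 0%N ->
  exists2 j, j \in zeros P i1 & j \notin zeros P i0.
Proof.
move=> adm ne_i i0P i1P shift0 shift1; apply/subsetPn/negP => sZ.
have cf : common_factor P [set i0; i1] (zeros P i1) 0.
  by apply/forall_inP => i /set2P[]->; rewrite ?sZ ?subxx.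
have : (mult P i0 + mult P i1 + #|zeros P i1| + 0 <= k)%N.
  rewrite -(big_set1 addn i1) -big_setU1 ?inE //.
  apply: common_factor_leq adm _ _ _ _ _ cf.
    by rewrite subUset !sub1set i0P.
  by apply/set0Pn; exists i0; rewrite set21.
have := active_degree adm i1P; move: i0P; rewrite shift1 inE; lia.
Qed.

Theorem generically_admissible_indep k P :
  admissible k P -> generically (pattern_indep P).
Proof.
have [n] := ubnP (weight k P).
elim: n k P => // n IHn k P; rewrite ltnS => le_n adm.
have lighter_generic k' P' : (weight k' P' < weight k P)%N ->
    admissible k' P' -> generically (pattern_indep P').
  by move=> /leq_trans/(_ le_n); apply: IHn.
have [P0|/set0Pn[i iP]] := eqVneq (active P) set0.
  by apply: generically_true => g; apply: pattern_indep_inactive.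
have [[O [B [t tightO]]]|not_tight] := exists_tight_or_none k P.
  have /and4P[O_proper O_gt1 _ _] := tightO.
  have [i0 i0O] : exists i0, i0 \in O by apply/card_gt0P; lia.
  have gen_restricted := lighter_generic _ _ (weight_restrict k O_proper)
    (admissible_restrict O adm).
  have gen_merged := lighter_generic _ _ (weight_merge tightO i0O)
    (admissible_merge adm tightO i0O).
  apply: generically_imp (generically_and Kinf gen_restricted gen_merged) => g.
  by case; apply: pattern_indep_merge adm tightO i0O.
have [[i0 [i1 [i0P i1P ne_i shift0 shift1]]]|uniq0] :=
    exists_unshifted_pair_or_unique P.
  have [j ji1 ji0] := exists_separating_zero adm ne_i i0P i1P shift0 shift1.
  apply/generically_pattern_indep/(@pattern_indep_vanish j)/generically_exists.
  apply: lighter_generic (weight_vanish k ji1) _.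
  exact: admissible_vanish adm not_tight i0P shift0 ji0.
have k_gt0 : (0 < k)%N.
  by have := active_degree adm iP; move: iP; rewrite inE; lia.
have gen_cancelled := lighter_generic _ _ (weight_cancelX P k_gt0)
  (admissible_cancelX adm uniq0).
have gen_coef0 := generically_all Kinf (fun i =>
  generically_annih_set_coef0 phiE q_gt1 Kinf alpha_neq0 (zeros P i)).
apply: generically_imp (generically_and Kinf gen_coef0 gen_cancelled) => g [].
by move=> coef0; apply: pattern_indep_cancelX.
Qed.

End GenericIndependence.

(** * Enlarging the zero sets *)

Section ZeroSetExtension.
Variables (I T : finType) (k : nat).
Implicit Types (Z : T -> {set I}) (O : {set T}).

Definition mds_condition Z : bool :=
  [forall O : {set T}, (O != set0) ==> (#|\bigcap_(i in O) Z i| + #|O| <= k)%N].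

Lemma mds_conditionP Z :
  reflect (forall O, O != set0 -> #|\bigcap_(i in O) Z i| + #|O| <= k)%N
    (mds_condition Z).
Proof. by apply: (iffP forallP) => cond O; apply/implyP; apply: cond. Qed.

Definition critical Z O : bool := (#|\bigcap_(i in O) Z i| + #|O| == k)%N.

Definition add_zero Z i j x : {set I} := if x == i then j |: Z x else Z x.

Lemma critical_setI Z O1 O2 i : mds_condition Z -> i \in O1 :&: O2 ->
  critical Z O1 -> critical Z O2 -> critical Z (O1 :&: O2).
Proof.
move=> /mds_conditionP cond iO12 /eqP crit1 /eqP crit2.
have /setIP[iO1 _] := iO12.
have condU := cond (O1 :|: O2); have condI := cond (O1 :&: O2).
rewrite /critical eqn_leq condI /=; last by apply/set0Pn; exists i.
have {condU} : (#|\bigcap_(x in O1 :|: O2) Z x| + #|O1 :|: O2| <= k)%N.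
  by apply: condU; apply/set0Pn; exists i; rewrite inE iO1.
rewrite bigcap_setU; move: crit1 crit2.
set C1 := \bigcap_(x in O1) Z x; set C2 := \bigcap_(x in O2) Z x.
have : C1 :|: C2 \subset \bigcap_(x in O1 :&: O2) Z x.
  apply/bigcapsP => x /setIP[xO1 xO2].
  by rewrite subUset !bigcap_inf.
move/subset_leq_card; have := cardsUI C1 C2; have := cardsUI O1 O2; lia.
Qed.

Lemma critical_add_zero Z i j :
    mds_condition Z -> j \notin Z i -> ~~ mds_condition (add_zero Z i j) ->
  exists O,
    [/\ i \in O, forall x, x \in O -> x != i -> j \in Z x & critical Z O].
Proof.
move=> /mds_conditionP cond jZ /forallPn[O].
rewrite negb_imply -ltnNge => /andP[O0 lt_k].
set C' := \bigcap_(x in O) _ in lt_k; have := cond O O0.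
set C := \bigcap_(x in O) Z x => le_k.
have sC' : C' \subset j |: C.
  apply/subsetP => y /bigcapP yC'; rewrite in_setU1; case: eqP => //= yj.
  apply/bigcapP => x xO; have := yC' x xO; rewrite /add_zero; case: eqP => // _.
  by rewrite in_setU1 => /predU1P[].
have jC' : j \in C'.
  apply: contraTT lt_k => jC'; rewrite -leqNgt (leq_trans _ le_k) // leq_add2r.
  apply/subset_leq_card/subsetP => y yC'; have := subsetP sC' y yC'.
  by rewrite in_setU1 => /predU1P[yj|//]; rewrite -yj yC' in jC'.
have j_other x : x \in O -> x != i -> j \in Z x.
  move=> xO /negPf ne_xi; have /bigcapP/(_ x xO) := jC'.
  by rewrite /add_zero ne_xi.
exists O; split=> //.
  apply: contraTT lt_k => iO; rewrite -leqNgt; suff -> : C' = C by [].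
  apply: eq_bigr => x xO; rewrite /add_zero.
  by case: eqP => // xi; rewrite -xi xO in iO.
rewrite /critical eqn_leq le_k -ltnS (leq_trans lt_k) // -addSn leq_add2r.
by rewrite (leq_trans (subset_leq_card sC')) // cardsU1 -add1n leq_add2r leq_b1.
Qed.

(* If neither [j1] nor [j2] can be added to [Z i], the critical families that
   prevent it meet in a critical family; dropping [i] from the latter gains both
   [j1] and [j2]. *)
Lemma mds_condition_add_zero Z i :
  mds_condition Z -> (#|Z i|.+1 < k <= #|I|)%N ->
  exists2 j, j \notin Z i & mds_condition (add_zero Z i j).
Proof.
move=> cond /andP[lt_k le_k].
have /card_gt1P[j1 [j2 []]] : (1 < #|~: Z i|)%N by have := cardsC (Z i); lia.
rewrite !inE => j1Z j2Z ne_j.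
have [|/(critical_add_zero cond j1Z)[O1 [iO1 j1_other crit1]]] :=
    boolP (mds_condition (add_zero Z i j1)); first by exists j1.
have [|/(critical_add_zero cond j2Z)[O2 [iO2 j2_other crit2]]] :=
    boolP (mds_condition (add_zero Z i j2)); first by exists j2.
exfalso; pose O := O1 :&: O2; have iO : i \in O by rewrite inE iO1.
have /eqP crit := critical_setI cond iO crit1 crit2.
have [O'0|O'_neq0] := eqVneq (O :\ i) set0.
  have OE : O = [set i].
    by apply/eqP; rewrite eqEsubset sub1set iO andbT -setD_eq0 O'0.
  by move: crit lt_k; rewrite -/O OE big_set1 cards1; clear; lia.
have := mds_conditionP _ cond _ O'_neq0; set C' := \bigcap_(x in O :\ i) Z x.
pose C := \bigcap_(x in O) Z x; have CZ : C \subset Z i by apply: bigcap_inf.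
have : j1 |: (j2 |: C) \subset C'.
  apply/bigcapsP => x /setD1P[ne_xi xO]; have /setIP[xO1 xO2] := xO.
  by rewrite !subUset !sub1set j1_other // j2_other // bigcap_inf.
move/subset_leq_card; rewrite !cardsU1 !inE (negPf ne_j).
rewrite (contra (subsetP CZ j1) j1Z) (contra (subsetP CZ j2) j2Z) /=.
by move: crit; rewrite -/O -/C (cardsD1 i O) iO; clear; lia.
Qed.

Lemma mds_condition_extend Z : mds_condition Z -> (k <= #|I|)%N ->
  exists Z' : T -> {set I}, [/\ forall i, Z i \subset Z' i, mds_condition Z' &
    forall i, #|Z' i|.+1 = k].
Proof.
move=> cond le_k; have [n] := ubnP (\sum_i (k - #|Z i|.+1))%N.
elim: n Z cond => // n IHn Z cond; rewrite ltnS => le_n.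
have card_Z i : (#|Z i|.+1 <= k)%N.
  have := mds_conditionP _ cond [set i]; rewrite big_set1 cards1 addn1; apply.
  by apply/set0Pn; exists i; rewrite set11.
have [/existsP[i lt_k]|full] := boolP [exists i, #|Z i|.+1 < k]%N; last first.
  exists Z; split=> // i; apply/eqP; rewrite eqn_leq card_Z leqNgt.
  by apply: contra full => ?; apply/existsP; exists i.
have [|j jZ cond'] := mds_condition_add_zero (i := i) cond.
  by rewrite lt_k.
have [|Z' [sZ' condZ' cardZ']] := IHn _ cond'.
  apply: leq_trans le_n.
  rewrite (bigD1 i) //= [X in (_ < X)%N](bigD1 i) //= -addSn.
  rewrite leq_add //; first by rewrite /add_zero eqxx cardsU1 jZ; lia.
  by apply: leq_sum => x /negPf; rewrite /add_zero => ->.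
exists Z'; split=> // x; apply: subset_trans (sZ' x); rewrite /add_zero.
by case: ifP => // _; apply: subsetUr.
Qed.

End ZeroSetExtension.

(** * Moving the evaluation points into the finite field *)

Lemma size_det_leq (R : comNzRingType) n (M : 'M[{poly R}]_n)
    (d : 'I_n -> nat) :
  (forall i j, size (M i j) <= (d i).+1)%N ->
  (size (\det M) <= (\sum_i d i).+1)%N.
Proof.
move=> size_M; apply: leq_trans (size_sum _ _ _) _; apply/bigmax_leqP => s _.
rewrite mulr_sign (fun_if (fun p : {poly R} => size p)) size_polyN if_same.
apply: (big_ind2 (fun (p : {poly R}) e => size p <= e.+1)%N) => //.
  by rewrite size_poly1.
move=> p a p' a' size_p size_p'; apply: leq_trans (size_polyMleq _ _) _.
by rewrite -subn1 leq_subLR add1n -addSn -addnS leq_add.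
Qed.

Lemma nonroot_in_subfield (F : finFieldType) (K : fieldType)
    (iota : {rmorphism F -> K}) (h : {poly K}) :
  h != 0 -> (size h <= #|F|)%N -> exists x, ~~ root h (iota x).
Proof.
move=> h_neq0 size_h; apply/existsP.
apply: contraLR size_h => /existsPn all_roots.
rewrite -ltnNge cardE -(size_map iota); apply: max_poly_roots h_neq0 _ _.
  by apply/allP => _ /mapP[x _ ->]; apply: negbNE.
by rewrite map_inj_uniq ?enum_uniq //; apply: fmorph_inj.
Qed.

Section DegreeInOnePoint.
Variables (K : fieldType) (q : nat) (phi : {rmorphism K -> K}).
Hypothesis phiE : forall x, phi x = x ^+ q.
Hypothesis q_gt1 : (1 < q)%N.
Variables (I : finType) (alpha : I -> K) (k : nat).
Implicit Types (Z : 'I_k -> {set I}) (g : I -> K).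

Local Notation ann := (annih_set q phi alpha).

Definition annih_mx Z g : 'M[K]_k := \matrix_i poly_rV (ann g (Z i)).

Definition point_degree (j : I) (A : {set I}) : nat :=
  if j \in A then ((q - 1) * q ^ #|A|.-1)%N else 0%N.

Lemma coef_annih_move_point g j A l : exists2 h : {poly K},
  (size h <= (point_degree j A).+1)%N &
    forall y, (ann (move_point g j y) A)`_l = h.[y].
Proof.
rewrite /point_degree; have [jA|jA] := boolP (j \in A); last first.
  exists ((ann g A)`_l)%:P => [|y]; first exact: size_polyC_leq1.
  by rewrite annih_set_move_point // hornerC.
set f := ann g (A :\ j); pose ev_f := linearized_poly q phi (alpha j) f.
pose h := ((skewX phi f)`_l)%:P - (alpha j * f`_l) *: ev_f ^+ (q - 1).
exists h => [|y]; last first.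
  rewrite (annih_setD1 phiE q_gt1 _ _ jA) /= annih_set_move_point ?setD11 //.
  rewrite /conj_value move_pointE coefB coefZ !hornerE.
  by rewrite (horner_linearized_poly phiE) mulrAC.
apply: leq_trans (size_polyD _ _) _.
rewrite geq_max (leq_trans (size_polyC_leq1 _)) //=.
rewrite size_polyN; apply: leq_trans (size_scale_leq _ _) _.
apply: leq_trans (size_poly_exp_leq _ _) _; rewrite ltnS mulnC leq_mul2l.
apply/orP; right.
have := size_linearized_poly_leq phi q_gt1 (alpha j) f.
by rewrite size_annih_set [#|A|](cardsD1 j) jA add1n; case: (size _).
Qed.

Lemma det_annih_move_point Z g j : exists2 h : {poly K},
  (size h <= (\sum_i point_degree j (Z i)).+1)%N &
  forall y, \det (annih_mx Z (move_point g j y)) = h.[y].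
Proof.
have /fin_all_exists2[h size_h hE] (il : 'I_k * 'I_k) :=
  coef_annih_move_point g j (Z il.1) il.2.
exists (\det (\matrix_(i, l) h (i, l))).
  by apply: size_det_leq => i l; rewrite mxE; apply: (size_h (i, l)).
move=> y; rewrite -[RHS]/(horner_eval y _) -det_map_mx; congr (\det _).
by apply/matrixP => i l; rewrite !mxE (hE (i, l)).
Qed.

Lemma annih_mx_move_point_id Z g j :
  annih_mx Z (move_point g j (g j)) = annih_mx Z g.
Proof.
apply/matrixP => i l; rewrite !mxE (@eq_annih_set _ _ _ _ _ _ g) // => i' _.
by rewrite ffunE; case: eqP => [->|].
Qed.

End DegreeInOnePoint.

Lemma point_degree_count q m k o :
  (1 < q)%N -> (0 < m)%N -> (k * q ^ (k - 1) <= q ^ m)%N -> (o < k)%N ->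
  (o * ((q - 1) * q ^ (k - 2)) + q ^ m.-1 < q ^ m)%N.
Proof.
move=> q_gt1 m_gt0; rewrite -{1 3}(prednK m_gt0) expnS.
case: k => [|[|k]] // le_qm lt_o.
  move: lt_o; rewrite ltnS leqn0 => /eqP->.
  by rewrite mul0n ltn_Pmull // expn_gt0 ltnW.
have {}le_qm : (k.+2 * q ^ k <= q ^ m.-1)%N.
  by move: le_qm; rewrite subn1 /= expnS mulnCA leq_pmul2l // ltnW.
have : (o * q ^ k < q ^ m.-1)%N.
  by apply: leq_trans le_qm; rewrite ltn_pmul2r // expn_gt0 ltnW.
rewrite !subSS subn0 mulnCA => lt_qm.
rewrite -[X in (_ < X * _)%N](subnK (ltnW q_gt1)).
by rewrite mulnDl mul1n ltn_add2r ltn_pmul2l // subn_gt0.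
Qed.

Section Selection.
Variables (F : finFieldType) (K : fieldType) (iota : {rmorphism F -> K}).
Variables (q m n k : nat) (phi : {rmorphism K -> K}).
Hypothesis phiE : forall x, phi x = x ^+ q.
Hypothesis q_gt1 : (1 < q)%N.
Hypothesis Kinf : infinite_field K.
Hypothesis cardF : #|F| = (q ^ m)%N.
Hypothesis m_gt0 : (0 < m)%N.
Hypothesis k_gt0 : (0 < k)%N.
Hypothesis le_qm : (k * q ^ (k - 1) <= q ^ m)%N.
Variable alpha : 'I_n -> K.
Hypothesis alpha_neq0 : forall j, alpha j != 0.
Variable Z : 'I_k -> {set 'I_n}.
Hypothesis condZ : mds_condition k Z.
Hypothesis cardZ : forall i, #|Z i|.+1 = k.
Implicit Type g : {ffun 'I_n -> K}.

Local Notation ann := (annih_set q phi alpha).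
Local Notation T := (annih_mx q phi alpha Z).

Definition row_pattern : pattern 'I_n k := Pattern Z (fun=> 0%N) (fun=> 1%N).

Lemma admissible_row_pattern : admissible k row_pattern.
Proof.
split=> [i _|O B t _ O0 cf]; first by rewrite /= addn0 addn1.
have -> : t = 0%N.
  by have [i /(common_factorP cf)[_]] := set0Pn _ O0; rewrite leqn0 => /eqP.
rewrite sum1_card addn0 addnC; apply: leq_trans (mds_conditionP _ _ condZ _ O0).
rewrite leq_add2r; apply/subset_leq_card/bigcapsP => i.
by case/(common_factorP cf).
Qed.

Lemma exists_annih_mx_unit : exists g, T g \in unitmx.
Proof.
have [g indep] := generically_exists (generically_admissible_indep phiE q_gt1
  Kinf alpha_neq0 admissible_row_pattern).
exists g; rewrite -row_free_unit; apply: inj_row_free => v vT0.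
apply/rowP => i; rewrite mxE; apply: polyC_inj; move: i.
apply: indep => [i|]; first exact: size_polyC_leq1.
have size_row (i : 'I_k) : (size (v 0 i *: ann g (Z i))%R <= k)%N.
  by rewrite (leq_trans (size_scale_leq _ _)) // size_annih_set cardZ.
transitivity (\sum_i v 0 i *: ann g (Z i)).
  by apply: eq_bigr => i _; rewrite [LHS]skew_actC.
rewrite -(@poly_rV_K _ k (\sum_i _)); last first.
  by apply: leq_trans (size_sum _ _ _) _; apply/bigmax_leqP.
transitivity (rVpoly (v *m T g)); last by rewrite vT0 linear0.
rewrite mulmx_sum_row linear_sum; congr (rVpoly _).
by apply: eq_bigr => i _; rewrite linearZ rowK.
Qed.

Lemma point_degree_bound j :
  (\sum_i point_degree q j (Z i) + q ^ m.-1 < q ^ m)%N.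
Proof.
pose O := [set i | j \in Z i].
have O_lt : (#|O| < k)%N.
  have [->|O0] := eqVneq O set0; first by rewrite cards0.
  have jO : j \in \bigcap_(i in O) Z i by apply/bigcapP => i; rewrite inE.
  have := mds_conditionP _ _ condZ _ O0; rewrite (cardsD1 j) jO; lia.
apply: leq_ltn_trans (point_degree_count q_gt1 m_gt0 le_qm O_lt).
rewrite leq_add2r -sum_nat_const [X in (_ <= X)%N]big_mkcond.
apply: leq_sum => i _; rewrite inE /point_degree.
by case: ifP => // _; rewrite -(cardZ i) subSS !subn1.
Qed.

Lemma move_into_subfield g j (B : {set 'I_n}) :
  T g \in unitmx -> (#|B| < m)%N ->
  exists2 x, T (move_point g j (iota x)) \in unitmx &
    skew_eval phi (alpha j) (ann g B) (iota x) != 0.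
Proof.
move=> Tg B_lt.
have [h size_h hE] := det_annih_move_point phiE q_gt1 alpha Z g j.
pose e := linearized_poly q phi (alpha j) (ann g B).
have h_neq0 : h != 0.
  move: Tg; rewrite unitmxE unitfE; apply: contraNneq => h0.
  by rewrite -(annih_mx_move_point_id _ _ _ Z g j) hE h0 horner0.
have e_neq0 : e != 0 by rewrite linearized_poly_neq0 ?annih_set_neq0.
have size_e : (size e <= (q ^ m.-1).+1)%N.
  apply: leq_trans (size_linearized_poly_leq _ q_gt1 _ _) _.
  by rewrite size_annih_set ltnS leq_exp2l //= -ltnS prednK.
have size_he : (size (h * e)%R <= #|F|)%N.
  rewrite cardF.
  apply: leq_trans (size_polyMleq _ _) (leq_trans _ (point_degree_bound j)).
  by rewrite -[(size h + _).-1]subn1 leq_subLR add1n -addnS -addSn leq_add.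
have [x] := nonroot_in_subfield iota (mulf_neq0 h_neq0 e_neq0) size_he.
rewrite rootM negb_or /root -hE (horner_linearized_poly phiE).
by case/andP=> det_x ev_x; exists x; rewrite // unitmxE unitfE.
Qed.

Variable prev : 'I_n -> {set 'I_n}.
Hypothesis prev_lt : forall i j, i \in prev j -> (i < j)%N.
Hypothesis prev_card : forall j, (#|prev j| < m)%N.

Lemma exists_points_in_subfield :
  exists beta : 'I_n -> F, let g := iota \o beta in T g \in unitmx /\
    forall j, skew_eval phi (alpha j) (ann g (prev j)) (g j) != 0.
Proof.
suff moved s : (s <= n)%N -> exists g,
    [/\ forall j : 'I_n, (j < s)%N -> exists x, g j = iota x, T g \in unitmx &
      forall j : 'I_n, (j < s)%N ->
        skew_eval phi (alpha j) (ann g (prev j)) (g j) != 0].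
  have [g [g_iota Tg ev_g]] := moved n (leqnn n).
  have /fin_all_exists[beta betaE] j : exists x, g j = iota x by apply: g_iota.
  have annE A : ann (iota \o beta) A = ann g A.
    by apply: eq_annih_set => j _; rewrite betaE.
  exists beta; split=> [|j]; last by rewrite annE /= -betaE ev_g.
  suff -> : T (iota \o beta) = T g by [].
  by apply/matrixP => i l; rewrite !mxE annE.
elim: s => [_|s IHs s_lt]; first by have [g] := exists_annih_mx_unit; exists g.
have [g [g_iota Tg ev_g]] := IHs (ltnW s_lt); pose j0 := Ordinal s_lt.
have ltE (j : 'I_n) : j != j0 -> (j < s.+1)%N = (j < s)%N.
  by rewrite -val_eqE /= ltnS leq_eqVlt => /negPf->.
have [x Tx ev_x] := move_into_subfield j0 Tg (prev_card j0).
exists (move_point g j0 (iota x)); split=> // j.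
  rewrite ffunE; case: eqVneq => [_ _|/ltE->]; first by exists x.
  exact: g_iota.
move=> j_le; rewrite annih_set_move_point; last first.
  by apply/negP => /prev_lt /=; rewrite ltnNge -ltnS j_le.
rewrite ffunE; have [->|/ltE ltEj] := eqVneq j j0; first exact: ev_x.
by rewrite ev_g // -ltEj.
Qed.

End Selection.

(** * Linearized Reed-Solomon codes *)

Section MDSMatrices.
Variables (F : fieldType) (k n : nat).
Implicit Types (M G : 'M[F]_(k, n)) (Z : 'I_k -> {set 'I_n}).

Definition mds_matrix M : Prop :=
  forall (v : 'rV_k) (C : {set 'I_n}), (k <= #|C|)%N ->
    (forall j, j \in C -> (v *m M) 0 j = 0) -> v = 0.

Hypothesis le_kn : (k <= n)%N.

Lemma mds_matrix_row_free M : mds_matrix M -> row_free M.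
Proof.
move=> mds; apply: inj_row_free => v vM0; apply: (mds v [set: 'I_n]) => [|j _].
  by rewrite cardsT card_ord.
by rewrite vM0 mxE.
Qed.

Lemma mds_matrix_generator G M :
  generator_of G M -> mds_matrix M -> mds_matrix G.
Proof.
move=> /andP[free /andP[/submxP[D GE] _]] mds v C le_kC zeros_vG.
apply: (row_free_inj free); rewrite mul0mx GE mulmxA.
suff -> : v *m D = 0 by rewrite mul0mx.
by apply: mds le_kC _ => j jC; rewrite -mulmxA -GE zeros_vG.
Qed.

Lemma mds_matrix_zeros G Z : mds_matrix G ->
  (forall i j, j \in Z i -> G i j = 0) -> mds_condition k Z.
Proof.
move=> mds zeros_G; apply/mds_conditionP => O O0; set B := \bigcap_(i in O) Z i.
pose A := [set j in take (k - #|B|) (enum (~: B))].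
have cardA : #|A| = (k - #|B|)%N.
  rewrite cardsE (card_uniqP _) ?take_uniq ?enum_uniq // size_take -cardE.
  by have := cardsC B; rewrite card_ord; case: ltnP; lia.
have disjBA : [disjoint B & A].
  rewrite disjoint_sym disjoint_subset; apply/subsetP => j; rewrite inE.
  by move/mem_take; rewrite mem_enum in_setC.
pose rowsO : 'I_#|O| -> 'I_k := enum_val.
pose colsA : 'I_#|A| -> 'I_n := enum_val.
pose H := mxsub rowsO colsA G; suff : row_free H.
  move/eqP => rankH; have := rank_leq_col H; rewrite rankH cardA.
  by move: O0; rewrite -card_gt0; lia.
apply: inj_row_free => w wH0; pose v := w *m rowsub rowsO 1%:M.
have vG j : (v *m G) 0 j = (w *m rowsub rowsO G) 0 j.
  by rewrite -mulmxA -rowsubE.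
have v0 : v = 0.
  apply: (mds v (B :|: A)) => [|j].
    by rewrite cardsU disjoint_setI0 // cards0 cardA; lia.
  rewrite vG mxE => /setUP[jB|jA].
    rewrite big1 // => i _; rewrite mxE zeros_G ?mulr0 //.
    by move/bigcapP: jB; apply; apply: enum_valP.
  have /rowP/(_ (enum_rank_in jA j)) := wH0; rewrite !mxE => wH_j.
  rewrite -[RHS]wH_j; apply: eq_bigr => i _.
  by rewrite !mxE /colsA enum_rankK_in.
apply/rowP => i; have /rowP/(_ (rowsO i)) := v0; rewrite !mxE => v_i.
rewrite -[RHS]v_i (bigD1 i) //= !mxE eqxx mulr1 big1 ?addr0 // => i' ne_i.
by rewrite !mxE (inj_eq enum_val_inj) (negPf ne_i) mulr0.
Qed.

End MDSMatrices.

Section Blocks.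
Variables (ell n : nat) (n_ : 'I_ell -> nat).

Lemma in_block_exists (j : 'I_n) :
  (\sum_(l < ell) n_ l)%N = n -> exists l, in_block n_ l j.
Proof.
move=> sum_n; have : (j < \sum_(l < ell) n_ l)%N by rewrite sum_n.
pose upto i := (\sum_(l < ell | (l < i)%N) n_ l)%N.
rewrite (eq_bigl [pred l : 'I_ell | l < ell]%N) => [|l /=]; last first.
  by rewrite ltn_ord.
rewrite -/(upto ell) => lt_j.
have upto_ex : exists i, (j < upto i)%N by exists ell.
have [i lt_i min_i] := ex_minnP upto_ex.
case: i lt_i min_i => [|i]; first by rewrite /upto big_pred0.
move=> lt_i min_i; have lt_ell : (i < ell)%N := min_i _ lt_j.
exists (Ordinal lt_ell); apply/andP; split; last exact: lt_i.
by rewrite leqNgt; apply/negP => /min_i; rewrite ltnn.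
Qed.

Lemma in_block_inj l l' j : in_block n_ l j -> in_block n_ l' j -> l = l'.
Proof.
have le_block (a b : 'I_ell) : in_block n_ a j -> in_block n_ b j -> (b <= a)%N.
  move=> /andP[_ lt_a] /andP[le_b _]; rewrite leqNgt; apply/negP => lt_ab.
  suff le_ab : (\sum_(r < ell | r <= a) n_ r <= \sum_(r < ell | r < b) n_ r)%N.
    by have := leq_trans lt_a (leq_trans le_ab le_b); rewrite ltnn.
  apply: sub_le_big => //= [x y|r]; first exact: leq_addr.
  by move/leq_ltn_trans; apply.
by move=> jl jl'; apply/val_inj/eqP; rewrite eqn_leq !le_block.
Qed.

Definition block_before (l : 'I_ell) (j : 'I_n) : {set 'I_n} :=
  [set i : 'I_n | in_block n_ l i && (i < j)%N].

Lemma card_block_before l (j : 'I_n) :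
  in_block n_ l j -> (#|block_before l j| < n_ l)%N.
Proof.
case/andP; set start := (\sum_(r < ell | _) _)%N => le_j.
have -> : (\sum_(r < ell | (r <= l)%N) n_ r = n_ l + start)%N.
  rewrite (bigD1 l) //=; congr (_ + _)%N.
  by apply: eq_bigl => r; rewrite ltn_neqAle andbC.
move=> lt_j; suff : (#|block_before l j| <= j - start)%N by lia.
rewrite cardE -(size_map val) -(size_iota start (j - start)).
apply: uniq_leq_size.
  by rewrite map_inj_uniq ?enum_uniq //; apply: val_inj.
move=> _ /mapP[i + ->]; rewrite mem_enum inE => /andP[/andP[le_i _] lt_ij].
by rewrite mem_iota subnKC // le_i.
Qed.

End Blocks.

Lemma Nq_iter_sigma_op (F : fieldType) q (phi : {rmorphism F -> F}) i a :
  (forall x, phi x = x ^+ q) -> (1 < q)%N ->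
  Nq q i a = iter i (sigma_op phi a) 1.
Proof.
move=> phiE q_gt1; have -> : Nq q i a = a ^+ (\sum_(j < i) q ^ j)%N.
  by rewrite /Nq !subn1 predn_exp mulKn // -subn1 subn_gt0.
elim: i => [|i IHi] /=; first by rewrite big_ord0.
rewrite -IHi /sigma_op phiE -exprM -exprS big_ord_recl expn0 add1n.
congr (_ ^+ _.+1).
by rewrite big_distrl; apply: eq_bigr => j _ /=; rewrite expnSr.
Qed.

Section Code.
Variables (F : fieldType) (q k ell n : nat) (n_ : 'I_ell -> nat).
Variables (phi : {rmorphism F -> F}) (a : 'I_ell -> F) (beta : 'I_n -> F).
Hypothesis phiE : forall x, phi x = x ^+ q.
Hypothesis q_gt1 : (1 < q)%N.
Variable blk : 'I_n -> 'I_ell.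
Hypothesis blkP : forall j, in_block n_ (blk j) j.

Local Notation alpha := (a \o blk).
Local Notation M := (LRS_matrix q k n_ a beta).

Lemma in_blockE l (j : 'I_n) : in_block n_ l j = (blk j == l).
Proof. by apply/idP/eqP => [jl|<- //]; apply: in_block_inj (blkP j) jl. Qed.

Lemma mul_rV_LRS_matrix (v : 'rV_k) j :
  (v *m M) 0 j = skew_eval phi (alpha j) (rVpoly v) (beta j).
Proof.
rewrite mxE (skew_evalE phiE _ _ (size_poly _ _)); apply: eq_bigr => i _.
rewrite coef_rVpoly_ord mxE (big_pred1 (blk j)) => [|l].
  by rewrite (Nq_iter_sigma_op _ _ phiE q_gt1).
by rewrite in_blockE eq_sym.
Qed.

Lemma LRS_generator_of_annih_mx (Z : 'I_k -> {set 'I_n}) : row_free M ->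
  annih_mx q phi alpha Z beta \in unitmx -> (forall i, #|Z i| < k)%N ->
  exists G : 'M_(k, n), generator_of G M /\ forall i j, j \in Z i -> G i j = 0.
Proof.
move=> free Tunit cardZ; set T := annih_mx q phi alpha Z beta in Tunit.
have eqTM : (T *m M :=: M)%MS by apply: eqmxMfull; rewrite row_full_unit.
exists (T *m M); split=> [|i j jZ].
  by apply/andP; split; [rewrite /row_free eqTM|apply/eqmxP].
have -> : (T *m M) i j = (row i T *m M) 0 j by rewrite -row_mul [RHS]mxE.
rewrite mul_rV_LRS_matrix rowK poly_rV_K ?size_annih_set //.
exact: (annih_set_root phiE q_gt1).
Qed.

Section Necessity.
Hypothesis par : LRS_params q n_ a beta.

Lemma LRS_rep_inj : injective a.
Proof.
have [_ [not_conj _]] := par; move=> l l' eq_a.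
apply/eqP/negPn/negP => /not_conj; apply.
by exists 1; rewrite oner_neq0 expr1n mulr1.
Qed.

Lemma LRS_class_indep : class_indep phi alpha [set: 'I_n] beta.
Proof.
have [_ [_ indep]] := par; move=> c b c_fixed sum0 j _ alpha_j.
apply: (indep (blk j) c) => // [i|]; first by rewrite /in_Fq -phiE c_fixed.
rewrite -[RHS]sum0; apply: eq_bigl => i.
by rewrite in_blockE inE /= -alpha_j (inj_eq LRS_rep_inj).
Qed.

Lemma LRS_mds : mds_matrix M.
Proof.
have [a_neq0 [not_conj _]] := par; move=> v C le_kC zeros_vM.
have alpha_conj i j : sigma_conj q (alpha i) (alpha j) -> alpha i = alpha j.
  by have [/= ->//|ne_blk /(not_conj _ _ ne_blk)] := eqVneq (blk i) (blk j).
apply: (can_inj rVpolyK); rewrite linear0.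
apply: (skew_poly_eq0 phiE q_gt1 (fun j => a_neq0 (blk j)) alpha_conj
  (class_indep_subset (subsetT C) LRS_class_indep)) => [|j /zeros_vM].
  exact: leq_trans (size_poly _ _) le_kC.
by rewrite mul_rV_LRS_matrix.
Qed.

End Necessity.

Lemma block_Fq_indep_of_eval l :
  (forall j : 'I_n, in_block n_ l j -> skew_eval phi (alpha j)
     (annih_set q phi alpha beta (block_before n_ l j)) (beta j) != 0) ->
  block_Fq_indep q n_ beta l.
Proof.
move=> eval_neq0 c c_Fq sum0 j0 j0l; apply/eqP/negPn/negP => c_j0.
have c_fixed i : phi (c i) = c i by rewrite phiE; apply/eqP/c_Fq.
pose in_support (j : 'I_n) := in_block n_ l j && (c j != 0).
have : in_support j0 by rewrite /in_support j0l.
case/(arg_maxnP val) => j /andP[jl c_j] last_j.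
have := congr1 (skew_eval phi (alpha j)
  (annih_set q phi alpha beta (block_before n_ l j))) sum0.
rewrite raddf0 raddf_sum (bigD1 j) //= big1 ?addr0 => [/eqP|i /andP[il ne_ij]].
  by rewrite skew_eval_fixed // mulf_eq0 (negPf c_j) (negPf (eval_neq0 j jl)).
rewrite skew_eval_fixed //.
have [->|c_i] := eqVneq (c i) 0; first by rewrite mul0r.
have -> : a (blk j) = alpha i.
  by move: il jl; rewrite !in_blockE => /eqP<- /eqP/(congr1 a).
rewrite (annih_set_root phiE q_gt1) ?mulr0 // inE il ltn_neqAle val_eqE ne_ij.
by apply: last_j; rewrite /in_support il.
Qed.

End Code.

Lemma exists_conj_class_reps (F : finFieldType) q m ell :
    (1 < q)%N -> #|F| = (q ^ m)%N -> (0 < m)%N -> (ell <= q - 1)%N ->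
  exists a : 'I_ell -> F,
    (forall l, a l != 0) /\
    (forall l l', l != l' -> ~ sigma_conj q (a l) (a l')).
Proof.
move=> q_gt1 cardF m_gt0 le_ell.
pose N := #|F|.-1; pose M := (\sum_(j < m) q ^ j)%N.
have cardF_N : #|F| = N.+1 by rewrite prednK // (ltnW (finNzRing_gt1 F)).
have N_gt0 : (0 < N)%N by rewrite -ltnS -cardF_N finNzRing_gt1.
have NM : N = ((q - 1) * M)%N by rewrite /N cardF predn_exp subn1.
have expN (x : F) : x != 0 -> x ^+ N = 1.
  move=> x_neq0; apply: (mulfI x_neq0).
  by rewrite -exprS -cardF_N expf_card mulr1.
have /hasP[w _ prim_w] : has N.-primitive_root (enum (predC1 (0 : F))).
  apply: has_prim_root; rewrite ?enum_uniq // -?cardE ?cardC1 //.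
  by apply/allP => x; rewrite mem_enum unity_rootE => /expN->.
have w_neq0 : w != 0.
  apply: contraTneq (oner_neq0 F) => w0.
  by rewrite -(prim_expr_order prim_w) w0 expr0n gtn_eqF ?eqxx.
have M_gt0 : (0 < M)%N by move: N_gt0; rewrite NM muln_gt0 => /andP[].
exists (fun l => w ^+ l); split=> [l|l l' ne_l [c [c_neq0]]].
  exact: expf_neq0.
move/(congr1 (fun x => x ^+ M)).
rewrite exprMn -(exprM c) -NM expN // mulr1 -!exprM => /eqP.
rewrite (eq_prim_root_expr prim_w) NM -!(mulnC M) -!muln_modr eqn_pmul2l //.
rewrite !modn_small ?(leq_trans (ltn_ord _) le_ell) //.
by rewrite eq_sym val_eqE (negPf ne_l).
Qed.

Lemma exists_frobenius_power (F : fieldType) p e : p \in [pchar F] ->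
  exists phi : {rmorphism F -> F}, forall x, phi x = x ^+ (p ^ e).
Proof.
move=> charF; elim: e => [|e [phi phiE]].
  by exists idfun => x; rewrite expr1.
exists (pFrobenius_aut charF \o phi) => x /=.
by rewrite pFrobenius_autE phiE -exprM -expnSr.
Qed.

Section Existence.
Variables (F : finFieldType) (p e m n k : nat) (phi : {rmorphism F -> F}).
Let q := (p ^ e)%N.
Hypothesis charF : p \in [pchar F].
Hypothesis phiE : forall x, phi x = x ^+ q.
Hypothesis q_gt1 : (1 < q)%N.
Hypothesis cardF : #|F| = (q ^ m)%N.
Hypothesis m_gt0 : (0 < m)%N.
Hypothesis k_gt0 : (0 < k)%N.
Hypothesis le_qm : (k * q ^ (k - 1) <= q ^ m)%N.
Variable Z : 'I_k -> {set 'I_n}.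
Hypothesis condZ : mds_condition k Z.
Hypothesis cardZ : forall i, #|Z i|.+1 = k.

Lemma exists_points (alpha : 'I_n -> F) (prev : 'I_n -> {set 'I_n}) :
    (forall j, alpha j != 0) -> (forall i j, i \in prev j -> (i < j)%N) ->
    (forall j, #|prev j| < m)%N ->
  exists beta : 'I_n -> F, annih_mx q phi alpha Z beta \in unitmx /\
    forall j, skew_eval phi (alpha j)
      (annih_set q phi alpha beta (prev j)) (beta j) != 0.
Proof.
move=> alpha_neq0 prev_lt prev_card.
have [K [iota _]] := countable_algebraic_closure F.
have charK : p \in [pchar K] by rewrite (fmorph_pchar iota).
have [phiK phiKE] := exists_frobenius_power e charK.
have iota_phi x : iota (phi x) = phiK (iota x) by rewrite phiE phiKE rmorphXn.
have alphaK_neq0 j : (iota \o alpha) j != 0 by rewrite fmorph_eq0.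
have Kinf : infinite_field K by move=> h /closed_nonrootP.
have [beta [unitT eval_neq0]] := exists_points_in_subfield iota phiKE q_gt1
  Kinf cardF m_gt0 k_gt0 le_qm alphaK_neq0 condZ cardZ prev_lt prev_card.
have annE A := map_annih_set q iota_phi alpha beta A.
exists beta; split=> [|j].
  rewrite -(map_unitmx iota).
  suff <- : annih_mx q phiK (iota \o alpha) Z (iota \o beta) =
    map_mx iota (annih_mx q phi alpha Z beta) by [].
  by apply/matrixP => i l; rewrite !mxE -annE coef_map.
by rewrite -(fmorph_eq0 iota) (map_skew_eval iota_phi) annE eval_neq0.
Qed.

Lemma exists_LRS_points ell (n_ : 'I_ell -> nat) (blk : 'I_n -> 'I_ell)
    (a : 'I_ell -> F) :
    (forall j, in_block n_ (blk j) j) -> (forall l, n_ l <= m)%N ->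
    (forall l, a l != 0) ->
    (forall l l', l != l' -> ~ sigma_conj q (a l) (a l')) ->
  exists beta : 'I_n -> F, LRS_params q n_ a beta /\
    annih_mx q phi (a \o blk) Z beta \in unitmx.
Proof.
move=> blkP le_nm a_neq0 not_conj; pose prev j := block_before n_ (blk j) j.
have prev_lt i j : i \in prev j -> (i < j)%N by rewrite inE => /andP[].
have prev_card j : (#|prev j| < m)%N.
  exact: leq_trans (card_block_before (blkP j)) (le_nm _).
have [beta [unitT eval_neq0]] :=
  exists_points (fun j => a_neq0 (blk j)) prev_lt prev_card.
exists beta; split=> //; split=> //; split=> // l.
apply: (block_Fq_indep_of_eval phiE q_gt1 blkP) => j.
by rewrite (in_blockE blkP) => /eqP<-; apply: eval_neq0.
Qed.

End Existence.

Theorem mainTheorem1 (q m ell n k : nat) (F : finFieldType)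
  (n_ : 'I_ell -> nat) (Z : 'I_k -> {set 'I_n}) :
  prime_power q ->
  #|F| = (q ^ m)%N ->
  (0 < ell)%N -> (0 < m)%N -> (0 < n)%N ->
  (1 <= k <= n)%N ->
  (ell <= q - 1)%N ->
  (forall l, 0 < n_ l)%N ->
  (\sum_(l < ell) n_ l)%N = n ->
  (ell.+1 <= q)%N ->
  (* m >= k - 1 + log_q k, i.e. k * q^(k-1) <= q^m *)
  (k * q ^ (k - 1) <= q ^ m)%N ->
  (forall l, n_ l <= m)%N ->
  (exists (a : 'I_ell -> F) (beta : 'I_n -> F),
      LRS_params q n_ a beta /\
      exists G : 'M[F]_(k, n),
        generator_of G (LRS_matrix q k n_ a beta) /\
        forall (i : 'I_k) (j : 'I_n), j \in Z i -> G i j = 0)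
  <->
  (forall Omega : {set 'I_k}, Omega != set0 ->
     (#|\bigcap_(i in Omega) Z i| + #|Omega| <= k)%N).
Proof.
move=> [p [e [p_pr [e_gt0 ->]]]] cardF _ m_gt0 _ /andP[k_gt0 le_kn] le_ell _.
move=> sum_n _ le_qm le_nm; have q_gt1 : (1 < p ^ e)%N.
  by rewrite -(exp1n e) ltn_exp2r ?prime_gt1.
have charF : p \in [pchar F].
  by apply: (card_finPcharP (n := (e * m)%N)) => //; rewrite cardF expnM.
have [phi phiE] := exists_frobenius_power e charF.
have /fin_all_exists[blk blkP] j := in_block_exists j sum_n.
split=> [[a [beta [par [G [genG zeros_G]]]]]|/mds_conditionP condZ].
  apply/mds_conditionP/(mds_matrix_zeros le_kn _ zeros_G).
  exact: mds_matrix_generator genG (LRS_mds phiE q_gt1 blkP par).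
have [|Z' [sZZ' condZ' cardZ']] := mds_condition_extend condZ.
  by rewrite card_ord.
have [a [a_neq0 not_conj]] := exists_conj_class_reps q_gt1 cardF m_gt0 le_ell.
have [beta [par unitT]] := exists_LRS_points charF phiE q_gt1 cardF m_gt0 k_gt0
  le_qm condZ' cardZ' blkP le_nm a_neq0 not_conj.
exists a, beta; split=> //.
have free := mds_matrix_row_free le_kn (LRS_mds (k := k) phiE q_gt1 blkP par).
have [|G [genG zeros_G]] :=
    LRS_generator_of_annih_mx phiE q_gt1 blkP free unitT.
  by move=> i; rewrite -(cardZ' i).
by exists G; split=> // i j jZ; apply/zeros_G/(subsetP (sZZ' i)).
Qed.
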